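(* Let $D=\{x_1<x_2<\dots<x_n\}\subset\mathbb{R}$ and let $F:D\to\mathbb{R}$ satisfy $F(x_i)\neq F(x_{i+1})$ for $i=1,\dots,n-1$. Let $\delta>0$, let $y_1<\dots<y_{K+1}$ be a maximal alternating sequence of $\delta$-extrema of $F$, and let $P=S_1,\dots,S_K$ be the maximal alternating $\delta$-segmentation of $D$ derived from it, i.e. the segmentation with segmentation points $x_1,y_2,\dots,y_K,x_n$. Then any alternating segmentation $Q$ of $D$ with $\mathrm{OMAFE}(Q)<\mathrm{OMAFE}(P)$ has at least $K+1$ segments.
   Context: Segmentations. A segmentation of $D$ into $K$ segments is a sequence of closed intervals $X_i=[y_i,y_{i+1}]$, $i=1,\dots,K$, given by segmentation points $y_1<\dots<y_{K+1}$ in $D$ with $y_1=\min D$, $y_{K+1}=\max D$. A segment $X_i$ is increasing if $F(\max X_i)>F(\min X_i)$, decreasing if $F(\max X_i)<F(\min X_i)$, and has no direction if these values are equal. A segmentation is alternating if its segments alternate between increasing and decreasing. OMAFE. For a segment $X$ that is increasing (resp. decreasing), $\mathrm{OMAFE}(F_{|X})=\min_{f}\max_{x\in D\cap X}|f(x)-F(x)|$, where $f:\mathbb{R}\to\mathbb{R}$ ranges over all (weakly) monotonic increasing (resp. decreasing) functions. For a segment with no direction the approximation is the best constant, with error $(\max F_{|X}-\min F_{|X})/2$. The OMAFE of a segmentation is the maximum of $\mathrm{OMAFE}(F_{|X_i})$ over its segments $X_i$ (each segment is approximated independently). Extrema. $x_i$ is a maximum if ($i\neq1$ implies $F(x_i)>F(x_{i-1})$)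 and ($i\ne n$ implies $F(x_i)>F(x_{i+1})$). Minima are defined similarly. An extremum is a maximum or a minimum. $\delta$-pairs. For $x<y$ in $D$, the tuple $x,y$ is a $\delta$-pair (a pair of scale $\delta$) if $|F(y)-F(x)|\ge\delta$ and for all $z\in D$ with $x<z<y$ one has $|F(z)-F(x)|<\delta$ and $|F(y)-F(z)|<\delta$. Its direction is increasing if $F(y)>F(x)$ and decreasing if $F(y)<F(x)$. A $\ast$-pair is a $\delta$-pair for some unspecified $\delta>0$; its scale is understood as the largest such $\delta$, namely $|F(y)-F(x)|$. A $\ast$-pair $x,y$ is contained in a $\ast$-pair $z_1,z_2$ if $[x,y]\subseteq[z_1,z_2]$. Maximal $\ast$-pairs. A $\ast$-pair $x,y$ is maximal if whenever $z_1,z_2$ is a $\ast$-pair of larger scale, of the same direction, containing $x,y$, there exists a $\ast$-pair $w_1,w_2$ of the opposite direction that is contained in $z_1,z_2$ and contains $x,y$. Scale labels. The scale label of an extremum is the maximum of the scales of the maximal $\ast$-pairs of which it is an end point. Maximal alternating sequences. A maximal alternating sequence of $\delta$-extrema is a sequence $y_1<\dots<y_{K+1}$ of extrema, each with scale label at least $\delta$, with alternating types (maximum/minimum), such that no sequence properly containing it has these same properties. *)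

(* Defs.v *)
From mathcomp Require Import all_boot all_order all_algebra.
From mathcomp Require Import boolp classical_sets reals.

Set Implicit Arguments.
Unset Strict Implicit.
Unset Printing Implicit Defensive.

Import Order.TTheory GRing.Theory Num.Theory.

Local Open Scope ring_scope.

(* The finite set D = {x_1 < ... < x_n} is a strictly increasing sequence
   [D : seq R], so that x_i is [D`_i.-1], min D is [head 0 D] and max D is
   [last 0 D]. A function on D is given as [F : R -> R]; every definition below
   only evaluates F at points of D. *)

Definition increasing_on (R : realType) (F : R -> R) (a b : R) : bool :=
  F a < F b.

Definition decreasing_on (R : realType) (F : R -> R) (a b : R) : bool :=
  F b < F a.

Definition same_direction (R : realType) (F : R -> R) (p q : R * R) : bool :=
  (increasing_on F p.1 p.2 && increasing_on F q.1 q.2)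
  || (decreasing_on F p.1 p.2 && decreasing_on F q.1 q.2).

Definition opposite_direction (R : realType) (F : R -> R) (p q : R * R) : bool :=
  (increasing_on F p.1 p.2 && decreasing_on F q.1 q.2)
  || (decreasing_on F p.1 p.2 && increasing_on F q.1 q.2).

(* A segmentation is the sequence [q] of its segmentation points. *)
Definition segmentation (R : realType) (D q : seq R) : Prop :=
  [/\ q != [::], sorted <%R q, {subset q <= D},
      head 0 q = head 0 D & last 0 q = last 0 D].

Definition segments (R : realType) (q : seq R) : seq (R * R) :=
  zip q (behead q).

(* Every segment has a direction, and consecutive directions differ. *)
Definition alternating (R : realType) (F : R -> R) (q : seq R) : bool :=
  all (fun X => increasing_on F X.1 X.2 || decreasing_on F X.1 X.2) (segments q)
  && sorted (opposite_direction F) (segments q).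

Definition approx_error (R : realType) (D : seq R) (F : R -> R) (X : R * R)
    (f : R -> R) : R :=
  \big[Num.max/0]_(x <- D | X.1 <= x <= X.2) `|f x - F x|.

Definition max_on (R : realType) (D : seq R) (F : R -> R) (X : R * R) : R :=
  \big[Num.max/F X.1]_(x <- D | X.1 <= x <= X.2) F x.

Definition min_on (R : realType) (D : seq R) (F : R -> R) (X : R * R) : R :=
  \big[Num.min/F X.1]_(x <- D | X.1 <= x <= X.2) F x.

(* As D is finite, both infima are attained: they are minima over f. *)
Definition omafe (R : realType) (D : seq R) (F : R -> R) (X : R * R) : R :=
  if increasing_on F X.1 X.2 then
    inf [set e | exists2 f : R -> R,
           {homo f : u v / u <= v} & e = approx_error D F X f]%classic
  else if decreasing_on F X.1 X.2 then
    inf [set e | exists2 f : R -> R,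
           {homo f : u v / u <= v >-> v <= u} & e = approx_error D F X f]%classic
  else (max_on D F X - min_on D F X) / 2.

Definition omafe_seg (R : realType) (D : seq R) (F : R -> R) (q : seq R) : R :=
  \big[Num.max/0]_(X <- segments q) omafe D F X.

Definition is_maximum (R : realType) (D : seq R) (F : R -> R) (x : R) : bool :=
  let i := index x D in
  [&& x \in D, (i != 0)%N ==> (F D`_i.-1 < F x)
    & (i.+1 != size D)%N ==> (F D`_i.+1 < F x)].

Definition is_minimum (R : realType) (D : seq R) (F : R -> R) (x : R) : bool :=
  let i := index x D in
  [&& x \in D, (i != 0)%N ==> (F x < F D`_i.-1)
    & (i.+1 != size D)%N ==> (F x < F D`_i.+1)].

Definition extremum (R : realType) (D : seq R) (F : R -> R) (x : R) : bool :=
  is_maximum D F x || is_minimum D F x.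

Definition delta_pair (R : realType) (D : seq R) (F : R -> R) (delta : R)
    (p : R * R) : Prop :=
  [/\ p.1 \in D, p.2 \in D, p.1 < p.2, delta <= `|F p.2 - F p.1| &
      forall z, z \in D -> p.1 < z < p.2 ->
        `|F z - F p.1| < delta /\ `|F p.2 - F z| < delta].

Definition star_pair (R : realType) (D : seq R) (F : R -> R) (p : R * R) : Prop :=
  exists2 delta : R, 0 < delta & delta_pair D F delta p.

Definition scale (R : realType) (F : R -> R) (p : R * R) : R :=
  `|F p.2 - F p.1|.

Definition contained (R : realType) (p q : R * R) : bool :=
  (q.1 <= p.1) && (p.2 <= q.2).

Definition maximal_pair (R : realType) (D : seq R) (F : R -> R) (p : R * R) : Prop :=
  star_pair D F p /\
  forall z, star_pair D F z -> scale F p < scale F z ->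
    same_direction F p z -> contained p z ->
    exists w, [/\ star_pair D F w, opposite_direction F p w,
                  contained w z & contained p w].

(* Scales being positive, the value 0 only serves for the empty maximum. *)
Definition scale_label (R : realType) (D : seq R) (F : R -> R) (x : R) : R :=
  \big[Num.max/0]_(p <- [seq (a, b) | a <- D, b <- D]
                  | `[< maximal_pair D F p >] && ((x == p.1) || (x == p.2)))
     scale F p.

Definition opposite_type (R : realType) (D : seq R) (F : R -> R) (x y : R) : bool :=
  (is_maximum D F x && is_minimum D F y)
  || (is_minimum D F x && is_maximum D F y).

Definition alternating_extrema (R : realType) (D : seq R) (F : R -> R) (delta : R)
    (y : seq R) : Prop :=
  [/\ sorted <%R y, all (extremum D F) y,
      all (fun x => delta <= scale_label D F x) y & sorted (opposite_type D F) y].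

Definition maximal_alternating_extrema (R : realType) (D : seq R) (F : R -> R)
    (delta : R) (y : seq R) : Prop :=
  alternating_extrema D F delta y /\
  forall y', alternating_extrema D F delta y' -> subseq y y' -> y' = y.

(* x_1, y_2, ..., y_K, x_n, where y = y_1, ..., y_{K+1} *)
Definition derived_segmentation (R : realType) (D y : seq R) : seq R :=
  head 0 D :: rcons (behead (take (size y).-1 y)) (last 0 D).

(* Main.v *)
Require Import Defs.
From mathcomp Require Import all_boot all_order all_algebra.
From mathcomp Require Import boolp classical_sets reals.
From mathcomp Require Import lra.
Import Order.TTheory GRing.Theory Num.Theory.
Local Open Scope ring_scope.

(* A window whose maximum drops by delta on both sides contains a labelled
   maximum, because pairs of opposite directions are either nested or do not
   overlap. Hence between consecutive delta-extrema y_i, y_{i+1} of a maximal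
   alternating sequence F stays between F(y_i) and F(y_{i+1}), moves by at least
   delta overall, and nowhere moves backwards by delta. If OMAFE(P) exceeds
   OMAFE(Q) = c / 2, some segment of P has a backward move larger than c, and
   c < delta; inserting it into y (or putting its extremal end before or after y)
   gives K + 1 alternating moves larger than c. A monotone piece of Q contains no
   such move of the opposite direction, so each of them needs its own segment. *)

(** * Star pairs and labelled extrema *)

(** A label comes from one maximal pair, which lies on one side of the extremum only. Maximality of
    the pair has to be turned into control on the other side: there [F] either falls by [delta]
    before exceeding the extremum or never exceeds it. This two-sided control is what the segment
    bounds use. Alternation limits what maximality of [y] forbids: between neighbours only a peak
    and a valley together could be inserted, while outside the ends of [y] a single extremum could
    be added. The first and last segments of P reach beyond [y] to the ends of D, so they need the
    second kind of exclusion. The condition c < [delta] makes the steps of [y] itself count as moves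
    larger than c. All arguments are carried out for maxima and rising segments; negating values and
    reversing D give the rest. *)

Lemma exists_argmax {R : realFieldType} {T : eqType} (s : seq T) (P : T -> Prop)
    (f : T -> R) (x0 : T) :
  x0 \in s -> P x0 ->
  exists x, [/\ x \in s, P x & forall t, t \in s -> P t -> f t <= f x].
Proof.
elim: s x0 => // a s IH x0.
have [[x1 [sx1 Px1]] _ _|none] := pselect (exists x1, x1 \in s /\ P x1); last first.
  rewrite inE => /orP[/eqP-> Pa|sx0 Px0]; last by case: none; exists x0.
  exists a; split; rewrite ?mem_head // => t.
  by rewrite inE => /orP[/eqP->//|st Pt]; case: none; exists t.
have [x [sx Px xmax]] := IH _ sx1 Px1.
have [[Pa lt_xa]|nota] := pselect (P a /\ f x < f a).
  exists a; split; rewrite ?mem_head // => t.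
  rewrite inE => /orP[/eqP->//|st Pt]; exact: le_trans (xmax t st Pt) (ltW lt_xa).
exists x; split; rewrite ?inE ?sx ?orbT // => t.
rewrite inE => /orP[/eqP->|st] Pt; last exact: xmax.
by rewrite leNgt; apply/negP => lt_xa; apply: nota.
Qed.

(** [F] may repeat a value at points that are not adjacent. Taking the first or last extremal point
    by the second key [g] yields the strict inequalities that a pair requires. *)
Lemma exists_lex_argmax {R : realFieldType} {T : eqType} (s : seq T)
    (P : T -> Prop) (f g : T -> R) (x0 : T) :
  x0 \in s -> P x0 ->
  exists x, [/\ x \in s, P x & forall t, t \in s -> P t ->
    f t <= f x /\ (f t = f x -> g t <= g x)].
Proof.
move=> sx0 Px0; have [x1 [sx1 Px1 x1max]] := exists_argmax s P f x0 sx0 Px0.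
have [//|x [sx [Px fx] xmax]] :=
  exists_argmax s (fun t => P t /\ f t = f x1) g x1 sx1.
exists x; split=> // t st Pt; rewrite fx; split; first exact: x1max.
by move=> ft; apply: xmax.
Qed.

(** [flip] exchanges maxima with minima, [mirror] exchanges left with right. An up pair mirrored
    becomes a down pair, so only the half turn [flip (mirror F)] preserves rises. *)
Definition flip {R : realFieldType} (F : R -> R) : R -> R := fun x => - F x.

Definition mirror {R : realFieldType} (F : R -> R) : R -> R := fun x => F (- x).

Lemma flipK {R : realFieldType} (F : R -> R) : flip (flip F) = F.
Proof. by apply/funext => x; rewrite /flip opprK. Qed.

Lemma mirrorK {R : realFieldType} (F : R -> R) : mirror (mirror F) = F.
Proof. by apply/funext => x; rewrite /mirror opprK. Qed.

Lemma mem_mirror {R : realFieldType} (D : seq R) (x : R) :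
  (x \in map -%R D) = (- x \in D).
Proof. by rewrite -{1}[x]opprK (mem_map oppr_inj). Qed.

Lemma map_oppK {R : realFieldType} (D : seq R) : map -%R (map -%R D) = D.
Proof. exact: mapK opprK D. Qed.

(** An increasing star pair freed of its scale and absolute values. Decreasing pairs are written as
    up pairs of [flip F]. *)
Definition up_star {R : realFieldType} (D : seq R) (F : R -> R) (a b : R) : Prop :=
  [/\ a \in D, b \in D, a < b, F a < F b &
      forall z, z \in D -> a < z -> z < b -> F a < F z /\ F z < F b].

Definition up_maximal {R : realFieldType} (D : seq R) (F : R -> R) (a b : R) : Prop :=
  up_star D F a b /\
  forall c d, up_star D F c d -> c <= a -> b <= d -> F b - F a < F d - F c ->
    exists w1 w2, [/\ up_star D (flip F) w1 w2,
                      c <= w1, w1 <= a, b <= w2 & w2 <= d].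

Lemma up_star_flipK {R : realFieldType} (D : seq R) (F : R -> R) (a b : R) :
  up_star D (flip (flip F)) a b <-> up_star D F a b.
Proof. by rewrite flipK. Qed.

(** If the pairs crossed, as in a < c < b < d, the up pair would force [F c < F b] and the down pair
    [F b < F c]. A shared end point already counts as nesting. *)
Lemma star_laminar {R : realFieldType} (D : seq R) (F : R -> R) (a b c d : R) :
  up_star D F a b -> up_star D (flip F) c d -> c < b -> a < d ->
  (a <= c /\ d <= b) \/ (c <= a /\ b <= d).
Proof.
rewrite /flip => -[Da Db ab Fab abP] [Dc Dd cd Fcd cdP] cb ad.
have [ac|ca] := lerP a c; have [db|bd] := lerP d b; first by left.
- have [eac|neac] := eqVneq a c; first by right; split; lra.
  have {}ac : a < c by rewrite lt_neqAle neac.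
  by have := abP c Dc ac cb; have := cdP b Db cb bd; lra.
- have [edb|nedb] := eqVneq d b; first by right; split; lra.
  have {}db : d < b by rewrite lt_neqAle nedb.
  by have := abP d Dd ad db; have := cdP a Da ca ad; lra.
- by right; split; lra.
Qed.

Lemma up_star_le {R : realFieldType} (D : seq R) (F : R -> R) (a b z : R) :
  up_star D F a b -> z \in D -> a <= z -> z <= b -> F a <= F z /\ F z <= F b.
Proof.
move=> [_ _ _ Fab abP] Dz az zb.
have [->|nza] := eqVneq z a; first by lra.
have [->|nzb] := eqVneq z b; first by lra.
have [||Faz Fzb] := abP z Dz; first by rewrite lt_neqAle eq_sym nza.
  by rewrite lt_neqAle nzb.
by lra.
Qed.

(* Among the up pairs containing [a, b] with no down pair in between, one of
   largest scale is maximal. *)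
Lemma up_star_in_maximal {R : realFieldType} (D : seq R) (F : R -> R) (a b : R) :
  up_star D F a b ->
  exists c d, [/\ up_maximal D F c d, c <= a, b <= d, F b - F a <= F d - F c &
    forall w1 w2, up_star D (flip F) w1 w2 -> c <= w1 -> w1 <= a -> b <= w2 ->
      d < w2].
Proof.
move=> ab; have [Da Db lt_ab Fab abP] := ab.
pose Z (p : R * R) := [/\ up_star D F p.1 p.2, p.1 <= a, b <= p.2 &
  forall w1 w2, up_star D (flip F) w1 w2 -> p.1 <= w1 -> w1 <= a -> b <= w2 ->
      p.2 < w2].
have Zab : Z (a, b).
  split=> //= w1 w2 [_ _ _ + _]; rewrite /flip => Fw aw1 w1a bw2.
  rewrite lt_neqAle bw2 andbT; apply/eqP => ebw2.
  have ew1a : w1 = a by lra.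
  by move: Fw; rewrite -ebw2 ew1a; lra.
have Dab : (a, b) \in [seq (x, y) | x <- D, y <- D] by exact: allpairs_f.
have [[c d] [_ [/= cd ca bd nocd] cdmax]] :=
  exists_argmax _ Z (fun p => F p.2 - F p.1) _ Dab Zab.
exists c, d; split=> //; last exact: (cdmax (a, b)).
split=> // c' d' cd' c'c dd' lt_scale.
have [_ _ lt_cd _ _] := cd; have [Dc' Dd' _ _ _] := cd'.
have : ~ Z (c', d').
  by move=> /(cdmax _ (allpairs_f _ Dc' Dd')) /=; lra.
move=> notZ; apply: contrapT => noW; apply: notZ.
split=> //=; [lra|lra|] => w1 w2 w c'w1 w1a bw2.
rewrite ltNge; apply/negP => w2d'; apply: noW; exists w1, w2.
have [_ _ lt_w _ _] := w.
case: (star_laminar _ _ _ _ _ _ cd w); [lra|lra| |].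
  by case=> cw1 w2d; have := nocd w1 w2 w cw1 w1a bw2; lra.
by case.
Qed.

Definition right_drop {R : realFieldType} (delta : R) (D : seq R) (F : R -> R)
    (y : R) : Prop :=
  exists r, [/\ r \in D, y < r, F r <= F y - delta &
    forall t, t \in D -> y <= t -> t <= r -> F t <= F y].

Definition right_top {R : realFieldType} (D : seq R) (F : R -> R) (y : R) : Prop :=
  forall t, t \in D -> y <= t -> F t <= F y.

Definition left_drop {R : realFieldType} (delta : R) (D : seq R) (F : R -> R)
    (y : R) : Prop :=
  exists l, [/\ l \in D, l < y, F l <= F y - delta &
    forall t, t \in D -> l <= t -> t <= y -> F t <= F y].

Definition left_top {R : realFieldType} (D : seq R) (F : R -> R) (y : R) : Prop :=
  forall t, t \in D -> t <= y -> F t <= F y.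

Definition top_label {R : realFieldType} (delta : R) (D : seq R) (F : R -> R)
    (y : R) : Prop :=
  (exists2 c, up_maximal D F c y & delta <= F y - F c) \/
  (exists2 d, up_maximal D (flip F) y d & delta <= F y - F d).

Lemma up_star_mirror {R : realFieldType} (D : seq R) (F : R -> R) (a b : R) :
  up_star D F a b -> up_star (map -%R D) (flip (mirror F)) (- b) (- a).
Proof.
rewrite /flip /mirror => -[Da Db ab Fab abP].
split; rewrite ?mem_mirror ?opprK // ?ltrN2 // => z.
rewrite mem_mirror => Dz bz za.
by have := abP _ Dz; rewrite !ltrN2 => []; first lra; lra.
Qed.

Lemma up_maximal_mirror {R : realFieldType} (D : seq R) (F : R -> R) (a b : R) :
  up_maximal D F a b -> up_maximal (map -%R D) (flip (mirror F)) (- b) (- a).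
Proof.
move=> [ab abmax]; split; first exact: up_star_mirror.
move=> c d cd cb ad lt_scale.
have [||||w1 [w2 [w cw1 w1a bw2 w2d]]] := abmax (- d) (- c).
- have := up_star_mirror _ _ _ _ cd; rewrite map_oppK.
  suff -> : flip (mirror (flip (mirror F))) = F by [].
  by apply/funext => x; rewrite /flip /mirror !opprK.
- lra.
- lra.
- by move: lt_scale; rewrite /flip /mirror !opprK; lra.
exists (- w2), (- w1); split; [exact: up_star_mirror w|lra..].
Qed.

Lemma top_label_mirror {R : realFieldType} (delta : R) (D : seq R) (F : R -> R)
    (y : R) :
  top_label delta D F y -> top_label delta (map -%R D) (mirror F) (- y).
Proof.
case=> -[c /up_maximal_mirror cy scale_c]; [right|left].
  by exists (- c); rewrite // /mirror !opprK.
exists (- c); last by rewrite /mirror !opprK.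
suff -> : mirror F = flip (mirror (flip F)) by [].
by apply/funext => x; rewrite /flip /mirror !opprK.
Qed.

(** The case of interest is a label from an up pair (c, y). Let t be the first later point above
    [F y]. Without a drop by [delta] before t, (c, t) is an up pair of larger scale, and maximality
    asks for a down pair starting at c and ending in [y, t]; but [F] stays above [F c] there. *)
Lemma top_label_right {R : realFieldType} (delta : R) (D : seq R) (F : R -> R)
    (y : R) :
  0 < delta -> top_label delta D F y -> right_drop delta D F y \/ right_top D F y.
Proof.
move=> delta0 [[c cy scale_c]|[d [yd _] scale_d]]; last first.
  have [Dy Dd lt_yd Fyd ydP] := yd.
  left; exists d; split=> // [|t Dt yt td]; first by lra.
  by have := up_star_le _ _ _ _ _ yd Dt yt td; rewrite /flip; lra.
have [[Dc Dy lt_cy Fcy cyP] cymax] := cy.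
have [ytop|noty] := pselect (right_top D F y); [by right|left].
move: noty => /existsNP[t0 /not_implyP[Dt0 /not_implyP[yt0 /negP]]].
rewrite -ltNge => Fyt0.
have [t [Dt [yt Fyt] tmin]] :=
  exists_argmax D (fun t => y <= t /\ F y < F t) -%R _ Dt0 (conj yt0 Fyt0).
have below_t z : z \in D -> y <= z -> z < t -> F z <= F y.
  move=> Dz yz zt; rewrite leNgt; apply/negP => Fyz.
  by have := tmin z Dz (conj yz Fyz); lra.
have [[r [Dr yr rt Fr]]|nodrop] :=
    pselect (exists r, [/\ r \in D, y < r, r < t & F r <= F y - delta]).
  by exists r; split=> // z Dz yz zr; apply: below_t => //; lra.
have above_c z : z \in D -> c < z -> z < t -> F c < F z.
  move=> Dz cz zt; have [zy|yz|->//] := ltgtP z y; first by have := cyP z Dz cz zy; lra.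
  rewrite ltNge; apply/negP => Fzc; apply: nodrop; exists z; split=> //; lra.
have neq_yt : y != t by apply/eqP => eyt; rewrite eyt ltxx in Fyt.
have {}yt : y < t by rewrite lt_neqAle neq_yt.
have ct : up_star D F c t.
  split=> //; [lra|lra|] => z Dz cz zt; split; first exact: above_c.
  have [zy|yz] := lerP y z; first by have := below_t z Dz zy zt; lra.
  by have := cyP z Dz cz yz; lra.
have [|||w1 [w2 [[Dw1 Dw2 lt_w Fw _] cw1 w1c yw2 w2t]]] := cymax c t ct.
- exact: lexx.
- lra.
- lra.
have ew1 : w1 = c by lra.
move: Fw; rewrite ew1 /flip.
have [->|nw2t] := eqVneq w2 t; first by lra.
have {}w2t : w2 < t by rewrite lt_neqAle nw2t.
have cw2 : c < w2 by lra.
by have := above_c w2 Dw2 cw2 w2t; lra.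
Qed.

Lemma top_label_left {R : realFieldType} (delta : R) (D : seq R) (F : R -> R)
    (y : R) :
  0 < delta -> top_label delta D F y -> left_drop delta D F y \/ left_top D F y.
Proof.
move=> delta0 /top_label_mirror /(top_label_right _ _ _ _ delta0).
case=> [[r r_drop]|top]; [left|right].
  move: r_drop; rewrite /mirror mem_mirror opprK => -[Dr yr Fr rP].
  exists (- r); split=> // [|t Dt rt ty]; first by lra.
  by have := rP (- t); rewrite mem_mirror opprK => /(_ Dt); apply; lra.
move=> t Dt ty; have := top (- t).
by rewrite mem_mirror /mirror !opprK => /(_ Dt); apply; lra.
Qed.

(** The alternatives [left_top] and [right_top] may hold together and carry no [delta]; the
    labelling pair itself guarantees a genuine drop on one side. *)
Lemma top_label_drop {R : realFieldType} (delta : R) (D : seq R) (F : R -> R)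
    (y : R) :
  0 < delta -> top_label delta D F y -> left_drop delta D F y \/ right_drop delta D F y.
Proof.
move=> delta0 [[c [cy _] scale_c]|[d [yd _] scale_d]].
  have [Dc Dy lt_cy Fcy cyP] := cy.
  left; exists c; split=> // [|t Dt ct ty]; first by lra.
  by have := up_star_le _ _ _ _ _ cy Dt ct ty; lra.
have [Dy Dd lt_yd Fyd ydP] := yd.
right; exists d; split=> // [|t Dt yt td]; first by lra.
by have := up_star_le _ _ _ _ _ yd Dt yt td; rewrite /flip; lra.
Qed.

(** * Segments between consecutive extrema *)

(* The condition on t says that no point of D lies strictly between t and x. *)
Definition local_max {R : realFieldType} (D : seq R) (F : R -> R) (x : R) : Prop :=
  forall t, t \in D ->
    (forall s, s \in D -> (t < s -> x <= s) /\ (s < t -> s <= x)) -> F t <= F x.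

Definition peak {R : realFieldType} (delta : R) (D : seq R) (F : R -> R) (x : R) :
    Prop :=
  [/\ x \in D, local_max D F x & top_label delta D F x].

Lemma peak_mirror {R : realFieldType} (delta : R) (D : seq R) (F : R -> R) (x : R) :
  peak delta D F x -> peak delta (map -%R D) (mirror F) (- x).
Proof.
case=> Dx xmax xtop; split; [by rewrite mem_mirror opprK| |exact: top_label_mirror].
move=> t; rewrite mem_mirror /mirror opprK => Dt nbr.
apply: xmax => // s Ds; have := nbr (- s).
by rewrite mem_mirror opprK => /(_ Ds) []; split; lra.
Qed.

Lemma local_max_window {R : realFieldType} (D : seq R) (F : R -> R) (x l r : R) :
  (forall t, t \in D -> l <= t -> t <= r -> F t <= F x) ->
  (l \in D /\ l < x) \/ (forall t, t \in D -> l <= t) ->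
  (r \in D /\ x < r) \/ (forall t, t \in D -> t <= r) ->
  local_max D F x.
Proof.
move=> xmax lP rP t Dt nbr; apply: xmax => //.
  case: lP => [[Dl lx]|]; last exact.
  by have := (nbr l Dl).1; case: ltP => // _ /(_ isT); lra.
case: rP => [[Dr xr]|]; last exact.
by have := (nbr r Dr).2; case: (ltP r t) => // _ /(_ isT); lra.
Qed.

(* Ties are why two candidates are needed: if neither the first nor the last
   maximum of the window were labelled, they would lie in overlapping maximal
   pairs of opposite directions, neither nested in the other. *)
Lemma exists_peak {R : realFieldType} (delta : R) (D : seq R) (F : R -> R)
    (l m r : R) :
  0 < delta -> m \in D -> r \in D -> l <= m -> m <= r ->
  (forall t, t \in D -> l <= t -> t <= r -> F t <= F m) ->
  (l \in D /\ F l <= F m - delta) \/ (forall t, t \in D -> l <= t) ->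
  F r <= F m - delta ->
  exists m', [/\ peak delta D F m', l <= m', m' < r & F m' = F m].
Proof.
move=> delta0 Dm Dr lm mr mmax lP Fr.
have [m2 [Dm2 [lm2 m2r Fm2] m2last]] :=
  exists_argmax D (fun t => [/\ l <= t, t <= r & F t = F m]) id m Dm
    (And3 lm mr (erefl _)).
(* [m2] is the last maximum of the window and [r0] the first minimum after it, so [m2], [r0] is a
   strict down pair. *)
have [r0 [Dr0 [m2r0 r0r] r0min]] :=
  exists_lex_argmax D (fun t => m2 <= t /\ t <= r) (flip F) -%R r Dr
    (conj m2r (lexx r)).
have Fr0 : F r0 <= F r by have := r0min r Dr (conj m2r (lexx r)); rewrite /flip; lra.
have {}m2r0 : m2 < r0.
  by rewrite lt_neqAle m2r0 andbT; apply/eqP => e; move: Fr0; rewrite -e; lra.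
have m2r0_down : up_star D (flip F) m2 r0.
  split=> //; first by rewrite /flip; lra.
  rewrite /flip => z Dz m2z zr0; split.
    have Fzm : F z <= F m by apply: mmax => //; lra.
    rewrite ltrN2 Fm2 lt_neqAle Fzm andbT.
    by apply/eqP => Fz; have : z <= m2 by [apply: m2last => //; split; lra]; lra.
  have [|le_z eq_z] := r0min z Dz; first by split; lra.
  rewrite lt_neqAle le_z andbT; apply/eqP => Fz; have := eq_z Fz; lra.
have peak_m2 : top_label delta D F m2 ->
    exists m', [/\ peak delta D F m', l <= m', m' < r & F m' = F m].
  move=> label_m2; exists m2; split=> //; last by lra.
  split=> //; apply: (local_max_window _ _ _ l r).
  - by move=> t Dt lt tr; rewrite Fm2; apply: mmax.
  - case: lP => [[Dl Fl]|]; [left; split=> //|by right].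
    by rewrite lt_neqAle lm2 andbT; apply/eqP => e; move: Fl; rewrite e; lra.
  - by left; split=> //; lra.
(* If this maximal pair starts at [m2], then [m2] is labelled. Otherwise [F c] exceeds the maximum
   of the window, so c lies left of [l]. The first maximum [m1] is then treated symmetrically,
   giving an end [d'] right of [r]. *)
have [c [d [cd_max cm2 r0d scale_cd nocd]]] := up_star_in_maximal _ _ _ _ m2r0_down.
have [cd _] := cd_max; have [Dc Dd lt_cd Fcd cdP] := cd.
move: scale_cd Fcd; rewrite /flip => scale_cd Fcd.
have [ecm2|ncm2] := eqVneq c m2.
  apply: peak_m2; right; exists d; rewrite -ecm2 // ecm2.
  by move: scale_cd; rewrite ecm2; lra.
have {}cm2 : c < m2 by rewrite lt_neqAle ncm2.
have Fc : F m < F c by have := cdP m2 Dm2 cm2; rewrite /flip => -[|]; lra.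
have cl : c < l.
  by rewrite ltNge; apply/negP => lc; have := mmax c Dc lc; lra.
case: lP => [[Dl Fl]|/(_ c Dc)]; last by lra.
have [m1 [Dm1 [lm1 m1r Fm1] m1first]] :=
  exists_argmax D (fun t => [/\ l <= t, t <= r & F t = F m]) -%R m Dm
    (And3 lm mr (erefl _)).
have [l0 [Dl0 [ll0 l0m1] l0min]] :=
  exists_lex_argmax D (fun t => l <= t /\ t <= m1) (flip F) id l Dl
    (conj (lexx l) lm1).
have Fl0 : F l0 <= F l by have := l0min l Dl (conj (lexx l) lm1); rewrite /flip; lra.
have {}l0m1 : l0 < m1.
  by rewrite lt_neqAle l0m1 andbT; apply/eqP => e; move: Fl0; rewrite e; lra.
have m1m2 : m1 <= m2 by apply: m2last.
have l0m1_up : up_star D F l0 m1.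
  split=> //; first by lra.
  move=> z Dz l0z zm1; split.
    have [|le_z eq_z] := l0min z Dz; first by split; lra.
    rewrite -ltrN2 lt_neqAle le_z andbT; apply/eqP => Fz; have := eq_z Fz; lra.
  have Fzm : F z <= F m by apply: mmax => //; lra.
  rewrite Fm1 lt_neqAle Fzm andbT.
  by apply/eqP => Fz; have : - z <= - m1 by [apply: m1first => //; split; lra]; lra.
have [c' [d' [cd'_max c'l0 m1d' scale_cd' nocd']]] :=
  up_star_in_maximal _ _ _ _ l0m1_up.
have [cd' _] := cd'_max; have [Dc' Dd' lt_cd' Fcd' cd'P] := cd'.
have [ed'm1|nd'm1] := eqVneq d' m1.
  exists m1; split=> //; last by lra.
  split=> //; last first.
    left; exists c'; rewrite -ed'm1 //.
    by move: scale_cd'; rewrite -ed'm1 in Fm1 *; lra.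
  apply: (local_max_window _ _ _ l r).
  - by move=> t Dt lt tr; rewrite Fm1; apply: mmax.
  - by left; split=> //; lra.
  - by left; split=> //; lra.
have {}m1d' : m1 < d' by rewrite lt_neqAle eq_sym nd'm1.
have Fd' : F m < F d' by have [||] := cd'P m1 Dm1; [lra|lra|lra].
have rd' : r < d'.
  by rewrite ltNge; apply/negP => d'r; have := mmax d' Dd'; lra.
(* The two maximal pairs overlap, so one contains the other; the container then holds an opposite
   pair of the kind excluded by [nocd] or [nocd']. *)
case: (star_laminar _ _ _ _ _ _ cd' cd); [lra|lra| |] => -[c_le d_le].
  by have := nocd' _ _ cd c_le; lra.
by have := nocd c' d' (iffRL (up_star_flipK _ _ _ _) cd') c_le; lra.
Qed.

(** The form in which maximality of [y] acts between a valley p and the next peak q. *)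
Definition no_peak_valley {R : realFieldType} (delta : R) (D : seq R) (F : R -> R)
    (p q : R) : Prop :=
  forall m1 m2, peak delta D F m1 -> peak delta D (flip F) m2 ->
    p < m1 -> m1 < m2 -> m2 < q -> False.

(** Suppose the maximum m over [p, q] exceeds [F q]. The label of q forces a fall by [delta] between
    m and q, hence a labelled valley; the label of p then puts [F p] at least [delta] below [F m],
    hence a labelled peak before that valley. *)
Lemma rise_le_end {R : realFieldType} (delta : R) (D : seq R) (F : R -> R) (p q : R) :
  0 < delta -> p \in D -> q \in D -> p < q ->
  top_label delta D (flip F) p -> top_label delta D F q ->
  no_peak_valley delta D F p q ->
  forall t, t \in D -> p <= t -> t <= q -> F t <= F q.
Proof.
move=> delta0 Dp Dq pq bottom_p top_q nopv t0 Dt0 pt0 t0q.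
rewrite leNgt; apply/negP => Ft0.
have [m [Dm [pm mq] mmax]] :=
  exists_argmax D (fun t => p <= t /\ t <= q) F t0 Dt0 (conj pt0 t0q).
have {t0 Dt0 pt0 t0q Ft0} Fm : F q < F m.
  exact: lt_le_trans Ft0 (mmax _ Dt0 (conj pt0 t0q)).
case: (top_label_left _ _ _ _ delta0 top_q) => [[l [Dl lq Fl lmax]]|qtop]; last first.
  by have := qtop m Dm mq; lra.
have ml : m < l by rewrite ltNge; apply/negP => lm; have := lmax m Dm lm mq; lra.
have [n [Dn [mn nq] nmin]] :=
  exists_argmax D (fun t => m <= t /\ t <= q) (flip F) l Dl (conj (ltW ml) (ltW lq)).
have Fn : F n <= F l.
  by have := nmin l Dl (conj (ltW ml) (ltW lq)); rewrite /flip lerN2.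
have [|||n' [valley_n' mn' n'q Fn']] :=
    exists_peak delta D (flip F) m n q delta0 Dn Dq mn nq.
- by move=> t Dt mt tq; apply: nmin.
- by left; split=> //; rewrite /flip; lra.
- by rewrite /flip; lra.
have {}Fn' : F n' = F n by apply: oppr_inj.
have [Dn' _ _] := valley_n'.
have Fpm : F p <= F m - delta.
  case: (top_label_right _ _ _ _ delta0 bottom_p).
    rewrite /flip => -[r [Dr pr Fr rmin]].
    have [rq|qr] := lerP r q; first by have := mmax r Dr (conj (ltW pr) rq); lra.
    by have := rmin n Dn; lra.
  by move=> /(_ n Dn); rewrite /flip; lra.
have [|||m' [peak_m' pm' m'n' Fm']] :=
    exists_peak delta D F p m n' delta0 Dm Dn' pm mn'.
- by move=> t Dt pt tn'; apply: mmax => //; lra.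
- by left.
- by lra.
apply: (nopv m' n') => //.
by rewrite lt_neqAle pm' andbT; apply/eqP => e; move: Fpm; rewrite e; lra.
Qed.

(** The half turn sends a rise from p to q to a rise from -q to -p, so the bound at the start
    follows from the one at the end. *)
Lemma no_peak_valley_rotate {R : realFieldType} (delta : R) (D : seq R) (F : R -> R)
    (p q : R) :
  no_peak_valley delta D F p q ->
  no_peak_valley delta (map -%R D) (flip (mirror F)) (- q) (- p).
Proof.
move=> nopv m1 m2 /peak_mirror peak_m1 /peak_mirror peak_m2 qm1 m12 m2p.
rewrite flipK mirrorK map_oppK in peak_m2.
rewrite map_oppK in peak_m1.
have e : mirror (flip (mirror F)) = flip F.
  by apply/funext => x; rewrite /flip /mirror opprK.
by rewrite e in peak_m1; apply: (nopv _ _ peak_m2 peak_m1); lra.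
Qed.

Lemma rise_ge_start {R : realFieldType} (delta : R) (D : seq R) (F : R -> R)
    (p q : R) :
  0 < delta -> p \in D -> q \in D -> p < q ->
  top_label delta D (flip F) p -> top_label delta D F q ->
  no_peak_valley delta D F p q ->
  forall t, t \in D -> p <= t -> t <= q -> F p <= F t.
Proof.
move=> delta0 Dp Dq pq /top_label_mirror bottom_p /top_label_mirror top_q.
move=> /no_peak_valley_rotate nopv t Dt pt tq.
have Dp' : - p \in map -%R D by rewrite mem_mirror opprK.
have Dq' : - q \in map -%R D by rewrite mem_mirror opprK.
have Dt' : - t \in map -%R D by rewrite mem_mirror opprK.
have qp' : - q < - p by rewrite ltrN2.
rewrite -[mirror F]flipK in top_q.
have := rise_le_end _ _ _ _ _ delta0 Dq' Dp' qp' top_q bottom_p nopv _ Dt'.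
by rewrite /flip /mirror !lerN2 !opprK; apply.
Qed.

(** If the rise were smaller than [delta], the witness for the label of p would lie outside [p, q],
    where [F] is confined between [F p] and [F q]. On that side the witness for q, if there is one,
    conflicts with it: the nearer of the two breaks the bound valid up to the farther one. If q has
    none, its bound on that whole side is broken. *)
Lemma rise_ge_delta {R : realFieldType} (delta : R) (D : seq R) (F : R -> R)
    (p q : R) :
  0 < delta -> p \in D -> q \in D -> p < q ->
  top_label delta D (flip F) p -> top_label delta D F q ->
  no_peak_valley delta D F p q ->
  delta <= F q - F p.
Proof.
move=> delta0 Dp Dq pq bottom_p top_q nopv; rewrite leNgt; apply/negP => small.
have Fq := rise_le_end _ _ _ _ _ delta0 Dp Dq pq bottom_p top_q nopv.
have Fp := rise_ge_start _ _ _ _ _ delta0 Dp Dq pq bottom_p top_q nopv.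
case: (top_label_drop _ _ _ _ delta0 bottom_p); rewrite /flip.
  move=> [l [Dl lp Fl lmin]].
  case: (top_label_left _ _ _ _ delta0 top_q) => [[d [Dd dq Fd dmax]]|qtop].
    have dp : d < p by rewrite ltNge; apply/negP => pd; have := Fp d Dd; lra.
    have [ld|dl] := lerP l d; first by have := lmin d Dd; lra.
    by have := dmax l Dl; lra.
  by have := qtop l Dl; lra.
move=> [r [Dr pr Fr rmin]].
have qr : q < r by rewrite ltNge; apply/negP => rq; have := Fq r Dr; lra.
case: (top_label_right _ _ _ _ delta0 top_q) => [[d [Dd qd Fd dmax]]|qtop].
  have [rd|dr] := lerP r d; first by have := dmax r Dr; lra.
  by have := rmin d Dd; lra.
by have := qtop r Dr; lra.
Qed.

(** A drop by [delta] would produce a labelled peak before v and then a labelled valley after that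
    peak: the confinement of [F] between [F p] and [F q] supplies the outer falls that [exists_peak]
    asks for. *)
Lemma rise_drop_lt {R : realFieldType} (delta : R) (D : seq R) (F : R -> R)
    (p q u v : R) :
  0 < delta -> p \in D -> q \in D -> p < q ->
  top_label delta D (flip F) p -> top_label delta D F q ->
  no_peak_valley delta D F p q ->
  u \in D -> v \in D -> p <= u -> u < v -> v <= q -> F u - F v < delta.
Proof.
move=> delta0 Dp Dq pq bottom_p top_q nopv Du Dv pu uv vq.
have Fq := rise_le_end _ _ _ _ _ delta0 Dp Dq pq bottom_p top_q nopv.
have Fp := rise_ge_start _ _ _ _ _ delta0 Dp Dq pq bottom_p top_q nopv.
rewrite ltNge; apply/negP => big.
have [m [Dm [pm mv] mmax]] :=
  exists_argmax D (fun t => p <= t /\ t <= v) F u Du (conj pu (ltW uv)).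
have Fum := mmax u Du (conj pu (ltW uv)).
have Fpv := Fp v Dv.
have [|||m' [peak_m' pm' m'v Fm']] := exists_peak delta D F p m v delta0 Dm Dv pm mv.
- by move=> t Dt pt tv; apply: mmax.
- by left; split=> //; lra.
- by lra.
have [Dm' _ _] := peak_m'.
have [n [Dn [m'n nq] nmin]] :=
  exists_argmax D (fun t => m' <= t /\ t <= q) (flip F) v Dv (conj (ltW m'v) vq).
have Fnv := nmin v Dv (conj (ltW m'v) vq); rewrite /flip lerN2 in Fnv.
have Fm'q := Fq m' Dm' pm'.
have [|||n' [valley_n' m'n' n'q Fn']] :=
    exists_peak delta D (flip F) m' n q delta0 Dn Dq m'n nq.
- by move=> t Dt mt tq; apply: nmin.
- by left; split=> //; rewrite /flip; lra.
- by rewrite /flip; lra.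
have {}Fn' : F n' = F n by apply: oppr_inj.
apply: (nopv m' n') => //.
  by rewrite lt_neqAle pm' andbT; apply/eqP => e; move: Fm'; rewrite -e; lra.
by rewrite lt_neqAle m'n' andbT; apply/eqP => e; move: Fm'; rewrite e; lra.
Qed.

(** Controls the part of the first segment of P that precedes [y]. *)
Lemma bottom_left_end {R : realFieldType} (delta : R) (D : seq R) (F : R -> R)
    (p : R) :
  0 < delta -> p \in D -> top_label delta D (flip F) p ->
  (forall m, peak delta D F m -> ~ m < p) ->
  forall u, u \in D -> u <= p -> F p <= F u /\ F u < F p + delta.
Proof.
move=> delta0 Dp bottom_p nopeak.
(* The window starts either at a point below [F p] or at the left end of D; both are admissible left
   boundaries for [exists_peak]. *)
have no_drop z l : (z \in D /\ F z < F p) \/ (forall t, t \in D -> z <= t) ->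
    l \in D -> z <= l -> l <= p -> F l < F p + delta.
  move=> zP Dl zl lp; rewrite ltNge; apply/negP => Fl.
  have [m [Dm [zm mp] mmax]] :=
    exists_argmax D (fun t => z <= t /\ t <= p) F l Dl (conj zl lp).
  have Flm := mmax l Dl (conj zl lp).
  have [|||m' [peak_m' _ m'p _]] := exists_peak delta D F z m p delta0 Dm Dp zm mp.
  - by move=> t Dt zt tp; apply: mmax.
  - by case: zP => [[Dz Fz]|zle]; [left; split=> //; lra|right].
  - by lra.
  by apply: nopeak m'p.
have pmin u : u \in D -> u <= p -> F p <= F u.
  move=> Du up; case: (top_label_left _ _ _ _ delta0 bottom_p); rewrite /flip.
    move=> [l [Dl lp Fl lmin]]; rewrite leNgt; apply/negP => Fup.
    have [lu|ul] := lerP l u; first by have := lmin u Du lu up; lra.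
    by have := no_drop u l (or_introl (conj Du Fup)) Dl; lra.
  by move=> /(_ u Du up); lra.
move=> u Du up; split; first exact: pmin.
have [x [_ _ xmin]] := exists_argmax D (fun=> True) -%R p Dp I.
have xle t : t \in D -> x <= t by move=> Dt; rewrite -lerN2; apply: xmin.
by apply: (no_drop x) => //; [right|apply: xle].
Qed.

Lemma bottom_right_end {R : realFieldType} (delta : R) (D : seq R) (F : R -> R)
    (p : R) :
  0 < delta -> p \in D -> top_label delta D (flip F) p ->
  (forall m, peak delta D F m -> ~ p < m) ->
  forall u, u \in D -> p <= u -> F p <= F u /\ F u < F p + delta.
Proof.
move=> delta0 Dp /top_label_mirror bottom_p nopeak u Du pu.
have := bottom_left_end delta (map -%R D) (mirror F) (- p) delta0.
rewrite mem_mirror opprK => /(_ Dp bottom_p) /(_ _ (- u)).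
rewrite mem_mirror /mirror !opprK lerN2; apply=> // m /peak_mirror.
by rewrite mirrorK map_oppK => /nopeak pm mp; apply: pm; lra.
Qed.

(** * OMAFE and swings *)

Lemma approx_error_ge {R : realType} (D : seq R) (F f : R -> R) (X : R * R) (x : R) :
  x \in D -> X.1 <= x <= X.2 -> `|f x - F x| <= approx_error D F X f.
Proof. by move=> Dx Xx; rewrite /approx_error; apply: le_bigmax_seq Dx Xx. Qed.

Lemma approx_error_ge0 {R : realType} (D : seq R) (F f : R -> R) (X : R * R) :
  0 <= approx_error D F X f.
Proof. exact: bigmax_ge_id. Qed.

Lemma approx_error_flip {R : realType} (D : seq R) (F f : R -> R) (X : R * R) :
  approx_error D (flip F) X (flip f) = approx_error D F X f.
Proof.
by apply: eq_bigr => x _; rewrite /flip -opprD normrN.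
Qed.

Lemma omafe_flip {R : realType} (D : seq R) (F : R -> R) (X : R * R) :
  F X.1 != F X.2 -> omafe D (flip F) X = omafe D F X.
Proof.
rewrite /omafe /increasing_on /decreasing_on /flip !ltrN2.
case: ltgtP => // _ _; congr inf; apply/seteqP; split=> e [f fmono ->].
- exists (flip f); last by rewrite -approx_error_flip flipK.
  by move=> u v uv; rewrite /flip lerN2; apply: fmono.
- exists (flip f); last by rewrite -approx_error_flip.
  by move=> u v uv; rewrite /flip lerN2; apply: fmono.
- exists (flip f); last by rewrite -approx_error_flip flipK.
  by move=> u v uv; rewrite /flip lerN2; apply: fmono.
- exists (flip f); last by rewrite -approx_error_flip.
  by move=> u v uv; rewrite /flip lerN2; apply: fmono.
Qed.

(** As [f u <= f v], the errors at u and v together absorb the whole drop, so one of them is at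
    least half of it. *)
Lemma omafe_increasing_ge {R : realType} (D : seq R) (F : R -> R) (X : R * R)
    (u v : R) :
  F X.1 < F X.2 -> u \in D -> v \in D -> X.1 <= u -> u <= v -> v <= X.2 ->
  F u - F v <= 2 * omafe D F X.
Proof.
move=> incX Du Dv Xu uv vX; rewrite /omafe /increasing_on incX.
rewrite mulrC -ler_pdivrMr //; apply: lb_le_inf.
  by exists (approx_error D F X (fun=> 0)), (fun=> 0).
move=> _ [f fmono ->]; have := fmono u v uv.
have := approx_error_ge D F f X u Du; rewrite Xu (le_trans uv vX) => /(_ isT).
have := approx_error_ge D F f X v Dv; rewrite vX (le_trans Xu uv) => /(_ isT).
by rewrite !ler_norml => /andP[? ?] /andP[? ?] ?; rewrite ler_pdivrMr //; lra.
Qed.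

(* The optimal approximation is the running maximum lowered by half of the
   largest drop. *)
Lemma omafe_increasing_le {R : realType} (D : seq R) (F : R -> R) (X : R * R)
    (e : R) :
  F X.1 < F X.2 -> 0 <= e ->
  (forall u v, u \in D -> v \in D -> X.1 <= u -> u < v -> v <= X.2 ->
    F u - F v <= e) ->
  X.1 \in D -> omafe D F X <= e / 2.
Proof.
move=> incX e0 drops DX1; rewrite /omafe /increasing_on incX.
(* The default [F X.1] is a value taken inside the segment, so [top] is a true running maximum. *)
pose top x := \big[Num.max/F X.1]_(t <- D | (X.1 <= t) && (t <= x)) F t.
pose f x := top x - e / 2.
have fmono : {homo f : u v / u <= v}.
  move=> u v uv; rewrite /f lerD2r /top; apply: sub_bigmax => t.
  by case/andP=> -> /le_trans ->.
apply: (@le_trans _ _ (approx_error D F X f)).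
  apply: ge_inf; last by exists f.
  by exists 0 => _ [g _ ->]; apply: approx_error_ge0.
rewrite /approx_error big_seq_cond; apply: bigmax_le; first by apply: divr_ge0.
move=> x /and3P[Dx Xx xX].
have drop t : t \in D -> X.1 <= t -> t <= x -> F t <= F x + e.
  move=> Dt Xt; rewrite le_eqVlt => /orP[/eqP->|tx]; first by lra.
  by have := drops t x Dt Dx Xt tx xX; lra.
have le_top : F x <= top x by apply: le_bigmax_seq Dx _; rewrite Xx lexx.
have top_le : top x <= F x + e.
  rewrite /top big_seq_cond; apply: bigmax_le; first exact: drop.
  by move=> t /and3P[Dt Xt tx]; apply: drop.
by rewrite ler_norml /f; apply/andP; split; lra.
Qed.

(* The boolean attached to a point is true for the top end of a swing. *)
Definition swing {R : realFieldType} (F : R -> R) (c : R) (a b : R * bool) : bool :=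
  [&& a.1 < b.1, b.2 == ~~ a.2 &
      c < (if b.2 then F b.1 - F a.1 else F a.1 - F b.1)].

(* A segment contains no swing of the opposite direction, so each swing must
   reach beyond the segments used by the previous ones. *)
Lemma swings_lt_segments {R : realType} (F : R -> R) (c : R) (E : {pred R})
    (q0 q1 : R) (qs : seq R) (w0 : R * bool) (w : seq (R * bool)) :
  alternating F [:: q0, q1 & qs] ->
  (forall X u v, X \in segments [:: q0, q1 & qs] -> u \in E -> v \in E ->
     X.1 <= u -> u < v -> v <= X.2 ->
     if F X.1 < F X.2 then F u - F v <= c else F v - F u <= c) ->
  path (swing F c) w0 w -> {in w0 :: w, forall a, a.1 \in E /\ a.1 <= last q1 qs} ->
  q0 <= w0.1 -> (F q0 < F q1) = w0.2 ->
  (size w < (size qs).+1)%N.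
Proof.
elim: qs q0 q1 w0 w => [|q2 qs IH] q0 q1 w0 [|w1 w] //= alt small.
  move=> /andP[/and3P[w01 /eqP w1E big] _] wE q0w0 dir.
  have [Ew0 _] := wE w0 (mem_head _ _).
  have [|Ew1 w1q1] := wE w1; first by rewrite !inE eqxx orbT.
  have := small (q0, q1) w0.1 w1.1 (mem_head _ _) Ew0 Ew1 q0w0 w01 w1q1.
  by move: big; rewrite /= dir w1E; case: w0.2 => /=; lra.
move=> /andP[/and3P[w01 /eqP w1E big] path_w] wE q0w0 dir.
have [Ew0 _] := wE w0 (mem_head _ _).
have [|Ew1 _] := wE w1; first by rewrite !inE eqxx orbT.
rewrite ltnS; apply: (IH q1 q2 w1 w) => //.
- by move: alt; rewrite /alternating /= => /andP[/andP[_ ->] /andP[_ ->]].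
- by move=> X u v X_seg; apply: small; rewrite inE X_seg orbT.
- by move=> a aw; apply: wE; rewrite inE aw orbT.
- rewrite leNgt; apply/negP => w1q1.
  have := small (q0, q1) w0.1 w1.1 (mem_head _ _) Ew0 Ew1 q0w0 w01 (ltW w1q1).
  by move: big; rewrite /= dir w1E; case: w0.2 => /=; lra.
move: alt; rewrite /alternating /= => /andP[/andP[_ /andP[dir1 _]] /andP[+ _]].
rewrite /opposite_direction /increasing_on /decreasing_on /= w1E -dir.
by case: (ltgtP (F q0)); case: (ltgtP (F q1)).
Qed.

(** If the first segment opposes the first swing, the strict count applies. Otherwise the first
    swing is discarded; the next one is opposed to the first segment, and the bound weakens by
    one. *)
Lemma swings_le_segments {R : realType} (F : R -> R) (c : R) (E : {pred R})
    (q0 : R) (qs : seq R) (w0 : R * bool) (w : seq (R * bool)) :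
  alternating F (q0 :: qs) ->
  (forall X u v, X \in segments (q0 :: qs) -> u \in E -> v \in E ->
     X.1 <= u -> u < v -> v <= X.2 ->
     if F X.1 < F X.2 then F u - F v <= c else F v - F u <= c) ->
  path (swing F c) w0 w ->
  {in w0 :: w, forall a, [/\ a.1 \in E, q0 <= a.1 & a.1 <= last q0 qs]} ->
  (size w <= size qs)%N.
Proof.
case: qs => [|q1 qs] alt small path_w wE.
  case: w path_w wE => // w1 w /= /andP[/and3P[w01 _ _] _] wE.
  have [|_ q0w0 _] := wE w0; first exact: mem_head.
  by have [|_ _ w1q0] := wE w1; [rewrite !inE eqxx orbT|lra].
have wE' : {in w0 :: w, forall a, a.1 \in E /\ a.1 <= last q1 qs}.
  by move=> a /wE[].
have [|_ q0w0 _] := wE w0; first exact: mem_head.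
have [dir|ndir] := eqVneq (F q0 < F q1) w0.2.
  by apply: ltnW; apply: (swings_lt_segments F c E q0 q1 qs w0 w).
case: w path_w wE wE' => // w1 w /= /andP[/and3P[w01 /eqP w1E _] path_w] wE wE'.
rewrite ltnS -ltnS; apply: (swings_lt_segments F c E q0 q1 qs w1 w) => //.
- by move=> a aw; apply: wE'; rewrite inE aw orbT.
- by lra.
by rewrite w1E; case: w0.2 ndir; case: (_ < _).
Qed.

(** * The paper's notions in terms of directed pairs *)

Lemma star_pair_flip {R : realType} (D : seq R) (F : R -> R) (p : R * R) :
  star_pair D F p -> star_pair D (flip F) p.
Proof.
have normB (x y : R) : `|- x - - y| = `|x - y| by rewrite -opprD normrN.
move=> [d d0 [Dp1 Dp2 ltp scale_p pP]]; exists d => //; split=> //.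
  by rewrite /flip normB.
by move=> z Dz /pP[] // *; rewrite /flip !normB.
Qed.

(** Both differences being below a scale d that is at most [F b - F a] means exactly that [F z] lies
    strictly between the end values; conversely d can be [F b - F a]. *)
Lemma up_starP {R : realType} (D : seq R) (F : R -> R) (a b : R) :
  up_star D F a b <-> star_pair D F (a, b) /\ F a < F b.
Proof.
split=> [[Da Db ab Fab abP]|[[d d0 [/= Da Db ab scale_ab abP]] Fab]].
  split=> //; exists (F b - F a); first by lra.
  split=> //=; first exact: ler_norm.
  by move=> z Dz /andP[az zb]; have := abP z Dz az zb; rewrite !ltr_norml; lra.
split=> // z Dz az zb; have := abP z Dz; rewrite az zb => /(_ isT).
rewrite ger0_norm in scale_ab; last by lra.
rewrite !ltr_norml => -[/andP[? ?] /andP[? ?]].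
by lra.
Qed.

Lemma maximal_pair_flip {R : realType} (D : seq R) (F : R -> R) (p : R * R) :
  maximal_pair D F p -> maximal_pair D (flip F) p.
Proof.
have flip_scale q : scale (flip F) q = scale F q.
  by rewrite /scale /flip -opprD normrN.
move=> [p_star pmax]; split=> [|z]; first exact: star_pair_flip.
move=> /star_pair_flip; rewrite flipK !flip_scale => z_star lt_scale.
rewrite /same_direction /increasing_on /decreasing_on /flip !ltrN2 orbC.
move=> same /(pmax z z_star lt_scale same)[w [w_star opp wz pw]].
exists w; split=> //; first exact: star_pair_flip.
by move: opp; rewrite /opposite_direction /increasing_on /decreasing_on !ltrN2 orbC.
Qed.

Lemma up_maximalP {R : realType} (D : seq R) (F : R -> R) (a b : R) :
  up_maximal D F a b <-> maximal_pair D F (a, b) /\ F a < F b.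
Proof.
rewrite /maximal_pair; split.
  move=> [ab abmax]; have [ab_star Fab] := (up_starP _ _ _ _).1 ab.
  split=> //; split=> // -[z1 z2] z_star lt_scale.
  rewrite /same_direction /increasing_on /decreasing_on /contained /= Fab.
  rewrite [F b < F a]ltNge (ltW Fab) /= orbF => Fz /andP[z1a bz2].
  have z_up : up_star D F z1 z2 by apply/up_starP.
  move: lt_scale; rewrite /scale /= !gtr0_norm ?subr_gt0 // => lt_scale.
  have [w1 [w2 [w z1w1 w1a bw2 w2z2]]] := abmax _ _ z_up z1a bz2 lt_scale.
  have [w_star Fw] := (up_starP _ _ _ _).1 w.
  exists (w1, w2); rewrite /opposite_direction /increasing_on /decreasing_on /= Fab.
  rewrite z1w1 w1a bw2 w2z2; split=> //; last by rewrite -ltrN2 Fw.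
  by rewrite -[F]flipK; apply: star_pair_flip.
move=> [[ab_star abmax] Fab]; split; first by apply/up_starP.
move=> c d /up_starP[cd_star Fcd] ca bd lt_scale.
have [|||[w1 w2] [w_star]] := abmax (c, d) cd_star.
- by rewrite /scale /= !gtr0_norm ?subr_gt0.
- by rewrite /same_direction /increasing_on /= Fab Fcd.
- by rewrite /contained /= ca bd.
rewrite /opposite_direction /increasing_on /decreasing_on /contained /= Fab.
rewrite [F b < F a]ltNge (ltW Fab) /= orbF => Fw /andP[cw1 w2d] /andP[w1a bw2].
exists w1, w2; split=> //; apply/up_starP; split; first exact: star_pair_flip.
by rewrite /flip ltrN2.
Qed.

(** Positivity of [delta] separates real scales from the default 0 of the empty maximum. *)
Lemma scale_label_geP {R : realType} (D : seq R) (F : R -> R) (delta x : R) :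
  0 < delta ->
  delta <= scale_label D F x <->
  exists p, [/\ maximal_pair D F p, x = p.1 \/ x = p.2 & delta <= scale F p].
Proof.
move=> delta0; split.
  apply: contraPP => none; apply/negP; rewrite -ltNge; apply: bigmax_lt => //.
  move=> p /andP[/asboolP p_max xp]; rewrite ltNge; apply/negP => scale_p.
  by apply: none; exists p; split=> //; case/orP: xp => /eqP; [left|right].
move=> [p [p_max xp scale_p]]; apply: le_trans scale_p _.
have [[d d0 [Dp1 Dp2 _ _ _]] _] := p_max.
apply: le_bigmax_seq.
  by case: p Dp1 Dp2 {p_max xp} => a b; apply: allpairs_f.
by rewrite asboolT //=; case: xp => ->; rewrite eqxx ?orbT.
Qed.

Lemma scale_label_flip {R : realType} (D : seq R) (F : R -> R) (delta x : R) :
  0 < delta -> delta <= scale_label D F x -> delta <= scale_label D (flip F) x.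
Proof.
move=> delta0 /(scale_label_geP _ _ _ _ delta0)[p [/maximal_pair_flip p_max xp]].
move=> scale_p; apply/scale_label_geP => //; exists p; split=> //.
by move: scale_p; rewrite /scale /flip -opprD normrN.
Qed.

(** The point of D right after x is at most [F x], whereas every later point of an up pair lies
    above its start. *)
Lemma local_max_up_star {R : realFieldType} (D : seq R) (F : R -> R) (x d : R) :
  local_max D F x -> ~ up_star D F x d.
Proof.
move=> xmax [Dx Dd xd Fxd xdP].
have [r [Dr xr rmin]] := exists_argmax D (fun t => x < t) -%R d Dd xd.
have rd : r <= d by rewrite -lerN2; apply: rmin.
have : F r <= F x.
  apply: xmax => // s Ds; split; first by lra.
  move=> sr; rewrite leNgt; apply/negP => xs.
  by have := rmin s Ds xs; lra.
have [->|nrd] := eqVneq r d; first by lra.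
by have := xdP r Dr xr; rewrite lt_neqAle nrd rd => /(_ isT); lra.
Qed.

Lemma local_max_down_star {R : realFieldType} (D : seq R) (F : R -> R) (c x : R) :
  local_max D F x -> ~ up_star D (flip F) c x.
Proof.
move=> xmax cx; apply: (@local_max_up_star _ (map -%R D) (mirror F) (- x) (- c)).
  move=> t; rewrite mem_mirror /mirror opprK => Dt nbr.
  apply: xmax => // s Ds; have := nbr (- s).
  by rewrite mem_mirror opprK => /(_ Ds) []; split; lra.
have := up_star_mirror _ _ _ _ cx.
have -> // : flip (mirror (flip F)) = mirror F.
by apply/funext => z; rewrite /flip /mirror opprK.
Qed.

(** A local maximum can only be the upper end of a pair: the right end of an up pair or the left end
    of a down pair. *)
Lemma top_labelP {R : realType} (D : seq R) (F : R -> R) (delta x : R) :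
  0 < delta -> local_max D F x ->
  top_label delta D F x <-> delta <= scale_label D F x.
Proof.
move=> delta0 xmax; rewrite scale_label_geP //; split.
  case=> [[c /up_maximalP[cx Fcx] scale_c]|[d /up_maximalP[xd Fxd] scale_d]].
    exists (c, x); split=> //; first by right.
    by rewrite /scale /= gtr0_norm ?subr_gt0.
  exists (x, d); split; [|by left|].
    by rewrite -[F]flipK; apply: maximal_pair_flip.
  rewrite /flip ltrN2 in Fxd.
  by rewrite /scale /= distrC gtr0_norm ?subr_gt0.
move=> [[a b] [p_max /= xp scale_p]]; rewrite /scale /= in scale_p.
have neq_Fab : F a != F b.
  by apply/eqP => Fab; move: scale_p; rewrite Fab subrr normr0; lra.
have [Fab|Fba] := ltP (F a) (F b).
  have ab : up_maximal D F a b by apply/up_maximalP.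
  case: xp => ex; first by case: (local_max_up_star _ _ _ b xmax); rewrite ex; case: ab.
  left; exists a; rewrite ex //.
  by rewrite gtr0_norm ?subr_gt0 in scale_p.
have {}Fba : F b < F a by rewrite lt_neqAle eq_sym neq_Fab.
have ab : up_maximal D (flip F) a b.
  by apply/up_maximalP; split; [exact: maximal_pair_flip|rewrite /flip ltrN2].
case: xp => ex.
  right; exists b; rewrite ex //.
  by rewrite distrC gtr0_norm ?subr_gt0 in scale_p.
by case: (local_max_down_star _ _ a _ xmax); rewrite ex; case: ab.
Qed.

Lemma is_minimum_flip {R : realType} (D : seq R) (F : R -> R) (x : R) :
  is_maximum D (flip F) x = is_minimum D F x.
Proof. by rewrite /is_maximum /is_minimum /flip !ltrN2. Qed.

(** Points with nothing of D strictly between them have equal or adjacent indices, and distinct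
    adjacent values make the weak inequality strict. *)
Lemma is_maximumP {R : realType} (D : seq R) (F : R -> R) (x : R) :
  sorted <%R D ->
  (forall i : nat, (i.+1 < size D)%N -> F D`_i != F D`_i.+1) ->
  is_maximum D F x <-> x \in D /\ local_max D F x.
Proof.
move=> D_sorted F_neq; rewrite /is_maximum.
case Dx: (x \in D) => /=; last by split=> // -[].
have lt_nth i j : (i < size D)%N -> (j < size D)%N -> (D`_i < D`_j) = (i < j)%N.
  by move=> iD jD; rewrite (lt_sorted_ltn_nth 0 D_sorted).
have iD : (index x D < size D)%N by rewrite index_mem.
have Di := nth_index 0 Dx; set i := index x D in iD Di *.
split.
  move=> /andP[left_lt right_lt]; split=> // t Dt nbr.
  have jD : (index t D < size D)%N by rewrite index_mem.
  have Dj := nth_index 0 Dt; set j := index t D in jD Dj.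
  have [ji|ij|eij] := ltngtP j i; last by rewrite -Di -Dj eij.
    have i0 : (i != 0)%N by rewrite -lt0n; apply: leq_ltn_trans ji.
    have i1D : (i.-1 < size D)%N by apply: leq_ltn_trans (leq_pred i) iD.
    have [nbr1 _] := nbr _ (mem_nth 0 i1D).
    have -> : t = D`_i.-1.
      rewrite -Dj; congr nth; apply/eqP; rewrite eqn_leq -ltnS prednK ?lt0n // ji /=.
      rewrite leqNgt; apply/negP => ji1; move: nbr1.
      rewrite -Dj -Di lt_nth // => /(_ ji1); rewrite leNgt lt_nth //.
      by rewrite prednK ?lt0n // leqnn.
    exact/ltW/(implyP left_lt).
  have i1D : (i.+1 < size D)%N by apply: leq_ltn_trans jD.
  have [_ nbr1] := nbr _ (mem_nth 0 i1D).
  have -> : t = D`_i.+1.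
    rewrite -Dj; congr nth; apply/eqP; rewrite eqn_leq ij andbT.
    rewrite leqNgt; apply/negP => i1j; move: nbr1.
    by rewrite -Dj -Di lt_nth // => /(_ i1j); rewrite leNgt lt_nth // leqnn.
  by apply/ltW/(implyP right_lt); rewrite neq_ltn i1D.
move=> [_ xmax].
have nbr_le j : (j < size D)%N -> (j.+1 == i) || (j == i.+1) -> F D`_j <= F x.
  move=> jD adj; apply: xmax => [|s Ds]; first exact: mem_nth.
  have kD : (index s D < size D)%N by rewrite index_mem.
  rewrite -(nth_index 0 Ds) -Di !leNgt !lt_nth // -!leqNgt.
  by case/orP: adj => /eqP; [move=> <-|move=> ->]; split=> // /ltnW // /leqW.
apply/andP; split; apply/implyP.
  rewrite -lt0n => i0; have i1D : (i.-1 < size D)%N.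
    exact: leq_ltn_trans (leq_pred i) iD.
  have Fle : F D`_i.-1 <= F x by apply: nbr_le => //; rewrite prednK // eqxx.
  by rewrite lt_neqAle Fle andbT -Di -{2}(prednK i0) F_neq ?prednK.
move=> i1D; have {}i1D : (i.+1 < size D)%N by rewrite ltn_neqAle i1D.
have Fle : F D`_i.+1 <= F x by apply: nbr_le => //; rewrite eqxx orbT.
by rewrite lt_neqAle Fle andbT -Di eq_sym F_neq.
Qed.

Lemma consecutive_neq_flip {R : realType} {D : seq R} {F : R -> R} :
  (forall i : nat, (i.+1 < size D)%N -> F D`_i != F D`_i.+1) ->
  forall i : nat, (i.+1 < size D)%N -> flip F D`_i != flip F D`_i.+1.
Proof. by move=> F_neq i iD; rewrite /flip eqr_opp F_neq. Qed.

Lemma peakP {R : realType} {delta : R} {D : seq R} {F : R -> R} {x : R} :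
  sorted <%R D ->
  (forall i : nat, (i.+1 < size D)%N -> F D`_i != F D`_i.+1) ->
  0 < delta ->
  peak delta D F x <-> is_maximum D F x /\ delta <= scale_label D F x.
Proof.
move=> D_sorted F_neq delta0; rewrite (is_maximumP _ _ _ D_sorted F_neq).
split=> [[Dx xmax]|[[Dx xmax]]]; move/(top_labelP _ _ _ _ delta0 xmax) => //.
Qed.

Lemma valleyP {R : realType} {delta : R} {D : seq R} {F : R -> R} {x : R} :
  sorted <%R D ->
  (forall i : nat, (i.+1 < size D)%N -> F D`_i != F D`_i.+1) ->
  0 < delta ->
  peak delta D (flip F) x <-> is_minimum D F x /\ delta <= scale_label D F x.
Proof.
move=> D_sorted F_neq delta0.
rewrite (peakP D_sorted (consecutive_neq_flip F_neq) delta0) is_minimum_flip.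
split=> -[xmin label]; split=> //; last exact: scale_label_flip.
by rewrite -[F]flipK; apply: scale_label_flip.
Qed.

(** Needed to tag valleys with false: in a one-point D a point is both maximum and minimum, but a
    label comes with a pair. *)
Lemma valley_not_local_max {R : realFieldType} (delta : R) (D : seq R) (F : R -> R)
    (x : R) :
  peak delta D (flip F) x -> ~ local_max D F x.
Proof.
move=> [_ _ [[c [cx _] _]|[d [xd _] _]]] xmax.
  exact: local_max_down_star xmax cx.
by rewrite flipK in xd; apply: local_max_up_star xmax xd.
Qed.

Lemma alternating_extrema_flip {R : realType} (D : seq R) (F : R -> R) (delta : R)
    (y : seq R) :
  0 < delta -> alternating_extrema D F delta y -> alternating_extrema D (flip F) delta y.
Proof.
have max_flip x : is_minimum D (flip F) x = is_maximum D F x.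
  by rewrite -is_minimum_flip flipK.
move=> delta0 [y_sorted y_ext y_label y_alt]; split=> //.
- by apply: sub_all y_ext => x; rewrite /Defs.extremum max_flip is_minimum_flip orbC.
- by apply: sub_all y_label => x; apply: scale_label_flip.
apply: sub_sorted y_alt => x z.
by rewrite /opposite_type !max_flip !is_minimum_flip orbC.
Qed.

Lemma maximal_alternating_flip {R : realType} (D : seq R) (F : R -> R) (delta : R)
    (y : seq R) :
  0 < delta -> maximal_alternating_extrema D F delta y ->
  maximal_alternating_extrema D (flip F) delta y.
Proof.
move=> delta0 [y_alt y_max]; split=> [|y' y'_alt]; first exact: alternating_extrema_flip.
by apply: y_max; rewrite -[F]flipK; apply: alternating_extrema_flip.
Qed.

(** * Insertions into a maximal alternating sequence *)

Lemma peak_valley_opposite {R : realType} (delta : R) (D : seq R) (F : R -> R)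
    (a b : R) :
  sorted <%R D ->
  (forall i : nat, (i.+1 < size D)%N -> F D`_i != F D`_i.+1) ->
  0 < delta -> peak delta D F a -> peak delta D (flip F) b ->
  opposite_type D F a b /\ opposite_type D F b a.
Proof.
move=> D_sorted F_neq delta0 /(peakP D_sorted F_neq delta0)[a_max _].
move=> /(valleyP D_sorted F_neq delta0)[b_min _].
by rewrite /opposite_type a_max b_min orbT.
Qed.

Lemma no_peak_valley_between {R : realType} (delta : R) (D : seq R) (F : R -> R)
    (s1 s2 : seq R) (p q : R) :
  sorted <%R D ->
  (forall i : nat, (i.+1 < size D)%N -> F D`_i != F D`_i.+1) ->
  0 < delta -> maximal_alternating_extrema D F delta (s1 ++ [:: p, q & s2]) ->
  peak delta D (flip F) p -> peak delta D F q -> no_peak_valley delta D F p q.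
Proof.
move=> D_sorted F_neq delta0 [[y_sorted y_ext y_label y_alt] y_max] valley_p peak_q.
move=> m1 m2 peak_m1 valley_m2 pm1 m12 m2q.
have [_ alt_pm1] := peak_valley_opposite _ _ _ _ _ D_sorted F_neq delta0 peak_m1 valley_p.
have [alt_m12 _] :=
  peak_valley_opposite _ _ _ _ _ D_sorted F_neq delta0 peak_m1 valley_m2.
have [_ alt_m2q] := peak_valley_opposite _ _ _ _ _ D_sorted F_neq delta0 peak_q valley_m2.
move: (peak_m1) (valley_m2).
move=> /(peakP D_sorted F_neq delta0)[m1_max label_m1].
move=> /(valleyP D_sorted F_neq delta0)[m2_min label_m2].
have /(congr1 size) : s1 ++ [:: p, m1, m2, q & s2] = s1 ++ [:: p, q & s2].
  apply: y_max.
  - split.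
    + move: y_sorted; rewrite !sorted_cat_cons /= => /and3P[-> _ ->].
      by rewrite pm1 m12 m2q.
    + move: y_ext; rewrite !all_cat /= => /and4P[-> -> -> ->].
      by rewrite /Defs.extremum m1_max m2_min orbT.
    + move: y_label; rewrite !all_cat /= => /and4P[-> -> -> ->].
      by rewrite label_m1 label_m2.
    move: y_alt; rewrite !sorted_cat_cons /= => /and3P[-> _ ->].
    by rewrite alt_pm1 alt_m12 alt_m2q.
  - apply: cat_subseq => //.
    rewrite -(cat1s p) -[[:: p, m1, m2, q & s2]]/([:: p; m1; m2] ++ q :: s2).
    by rewrite cat_subseq //= eqxx.
by rewrite !size_cat => /addnI /= /eqP; rewrite !eqSS gtn_eqF.
Qed.

Lemma no_peak_before {R : realType} (delta : R) (D : seq R) (F : R -> R)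
    (s : seq R) (p : R) :
  sorted <%R D ->
  (forall i : nat, (i.+1 < size D)%N -> F D`_i != F D`_i.+1) ->
  0 < delta -> maximal_alternating_extrema D F delta (p :: s) ->
  peak delta D (flip F) p -> forall m, peak delta D F m -> ~ m < p.
Proof.
move=> D_sorted F_neq delta0 [[y_sorted y_ext y_label y_alt] y_max] valley_p.
move=> m peak_m mp.
have [alt_mp _] := peak_valley_opposite _ _ _ _ _ D_sorted F_neq delta0 peak_m valley_p.
move: (peak_m) => /(peakP D_sorted F_neq delta0)[m_max label_m].
have /(congr1 size) : [:: m, p & s] = p :: s.
  apply: y_max.
  - split; rewrite /= in y_sorted y_ext y_label y_alt *.
    + by rewrite mp.
    + by rewrite /Defs.extremum m_max.
    + by rewrite label_m.
    by rewrite alt_mp.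
  - exact: subseq_cons.
by move=> /= /eqP; rewrite !eqSS gtn_eqF.
Qed.

Lemma no_peak_after {R : realType} (delta : R) (D : seq R) (F : R -> R)
    (s : seq R) (p : R) :
  sorted <%R D ->
  (forall i : nat, (i.+1 < size D)%N -> F D`_i != F D`_i.+1) ->
  0 < delta -> maximal_alternating_extrema D F delta (rcons s p) ->
  peak delta D (flip F) p -> forall m, peak delta D F m -> ~ p < m.
Proof.
move=> D_sorted F_neq delta0 [[y_sorted y_ext y_label y_alt] y_max] valley_p.
move=> m peak_m pm.
have [_ alt_pm] := peak_valley_opposite _ _ _ _ _ D_sorted F_neq delta0 peak_m valley_p.
move: (peak_m) => /(peakP D_sorted F_neq delta0)[m_max label_m].
have /(congr1 size) : s ++ [:: p; m] = rcons s p.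
  apply: y_max.
  - split.
    + by rewrite sorted_cat_cons y_sorted /= pm.
    + by move: y_ext; rewrite -cats1 !all_cat /= /Defs.extremum m_max !andbT.
    + by move: y_label; rewrite -cats1 !all_cat /= label_m !andbT.
    by rewrite sorted_cat_cons y_alt /= alt_pm.
  - by rewrite -[s ++ _]cat_rcons prefix_subseq.
by rewrite size_cat size_rcons addn2 => /eqP; rewrite eqSS gtn_eqF.
Qed.

(** * Segments of P, and swings counted against Q *)

Lemma sorted_consecutive {T : Type} (r : rel T) (s : seq T) :
  (forall s1 a b s2, s = s1 ++ [:: a, b & s2] -> r a b) -> sorted r s.
Proof.
case: s => //= a s; elim: s a => //= b s IH a consec.
rewrite (consec [::] a b s) //=; apply: IH => s1 c d s2 e.
by apply: (consec (a :: s1) c d s2); rewrite e.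
Qed.

Lemma mem_segments {R : realType} (q : seq R) (X : R * R) :
  X \in segments q -> exists r1 r2, q = r1 ++ [:: X.1, X.2 & r2].
Proof.
case: q => // a q; elim: q a => // b q IH a.
rewrite /segments /= inE => /orP[/eqP->|/IH[r1 [r2 e]]]; first by exists [::], q.
by exists (a :: r1), r2; rewrite e.
Qed.

(** With more than two points in [y], [s1] and [s2] are not both empty, so a segment of P has at
    most one end moved from [y] to an end of D. *)
Lemma mem_segments_derived {R : realType} (D y : seq R) (X : R * R) :
  (2 < size y)%N -> X \in segments (derived_segmentation D y) ->
  exists s1 p q s2, [/\ y = s1 ++ [:: p, q & s2],
    (0 < size s1 + size s2)%N,
    X.1 = (if s1 is [::] then head 0 D else p) &
    X.2 = (if s2 is [::] then last 0 D else q)].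
Proof.
case: y => // y0 y; case/lastP: y => // m yl y_size.
have -> : derived_segmentation D (y0 :: rcons m yl) = head 0 D :: rcons m (last 0 D).
  by rewrite /derived_segmentation /= size_rcons /= -[rcons m yl]cats1 take_size_cat.
rewrite /= size_rcons !ltnS in y_size.
move=> /mem_segments[[|a r1] [r2]] /= [e1]; case/lastP: r2 => [|r2 b].
- by move=> /(congr1 size); rewrite size_rcons => -[m0]; rewrite m0 in y_size.
- rewrite -rcons_cons => /rcons_inj[em _].
  exists [::], y0, X.2, (rcons r2 yl); rewrite em; split=> //.
    by rewrite /= size_rcons.
  by case: (r2).
- rewrite -[[:: X.1; X.2]]/(rcons [:: X.1] X.2) -rcons_cat => /rcons_inj[em <-].
  by exists (y0 :: r1), X.1, yl, [::]; rewrite em -cats1 -catA.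
rewrite -!rcons_cons -rcons_cat => /rcons_inj[em _].
exists (y0 :: r1), X.1, X.2, (rcons r2 yl); rewrite em -cat_cons rcons_cat; split=> //.
by case: (r2).
Qed.

Lemma sorted_head_last {R : realType} (D : seq R) (a : R) :
  sorted <%R D -> a \in D -> head 0 D <= a /\ a <= last 0 D.
Proof.
move=> D_sorted Da; have aD : (index a D < size D)%N by rewrite index_mem.
have D0 : (0 < size D)%N by apply: leq_ltn_trans aD.
have D1 : ((size D).-1 < size D)%N by rewrite prednK.
rewrite -nth0 -nth_last -(nth_index 0 Da).
by split; rewrite (lt_sorted_leq_nth 0 D_sorted) //= -ltnS prednK.
Qed.

(** A list of points carries one swing fewer than it has points, whence the successor. The factor 2
    is that of [omafe_increasing_ge], used for [flip F] on decreasing segments. *)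
Lemma swings_bound {R : realType} (D : seq R) (F : R -> R) (Q : seq R)
    (w : seq (R * bool)) :
  sorted <%R D -> segmentation D Q -> alternating F Q ->
  sorted (swing F (2 * omafe_seg D F Q)) w -> {in w, forall a, a.1 \in D} ->
  (size w <= (size (segments Q)).+1)%N.
Proof.
move=> D_sorted [+ _ _ + +]; case: Q => // q0 qs _ /= headQ lastQ alt.
case: w => // w0 w /= path_w wD.
rewrite /segments /= size_zip /= ltnS (minn_idPr (leqnSn _)).
apply: (swings_le_segments F _ (mem D) q0 qs w0 w) path_w _ => //.
  move=> X u v X_seg Du Dv Xu uv vX.
  have omafeX : omafe D F X <= omafe_seg D F (q0 :: qs) by apply: le_bigmax_seq X_seg _.
  have /orP dirX : increasing_on F X.1 X.2 || decreasing_on F X.1 X.2.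
    by case/andP: alt => /allP/(_ X X_seg).
  rewrite /increasing_on /decreasing_on in dirX.
  have [incX|decX] := ltP (F X.1) (F X.2).
    by have := omafe_increasing_ge D F X u v incX Du Dv Xu (ltW uv) vX; lra.
  have {dirX}decX : F X.2 < F X.1 by case: dirX => //; lra.
  have := omafe_increasing_ge D (flip F) X u v _ Du Dv Xu (ltW uv) vX.
  rewrite omafe_flip ?gt_eqF // /flip ltrN2 => /(_ decX); lra.
move=> a /wD Da; rewrite lastQ headQ.
by have [] := sorted_head_last _ _ D_sorted Da.
Qed.

Lemma alternating_flip {R : realType} (F : R -> R) (Q : seq R) :
  alternating F Q -> alternating (flip F) Q.
Proof.
rewrite /alternating => /andP[dirs alts]; apply/andP; split.
  apply: sub_all dirs => X.
  by rewrite /increasing_on /decreasing_on /flip !ltrN2 orbC.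
apply: sub_sorted alts => X Y.
by rewrite /opposite_direction /increasing_on /decreasing_on /flip !ltrN2 orbC.
Qed.

Lemma omafe_seg_flip {R : realType} (D : seq R) (F : R -> R) (Q : seq R) :
  alternating F Q -> omafe_seg D (flip F) Q = omafe_seg D F Q.
Proof.
case/andP=> /allP dirs _; apply: eq_big_seq => X /dirs.
rewrite /increasing_on /decreasing_on => dirX; apply: omafe_flip.
by rewrite neq_lt.
Qed.

(** * The derived segmentation *)

Lemma consecutive_extrema {R : realType} (delta : R) (D : seq R) (F : R -> R)
    (s1 s2 : seq R) (p q : R) :
  sorted <%R D ->
  (forall i : nat, (i.+1 < size D)%N -> F D`_i != F D`_i.+1) ->
  0 < delta -> alternating_extrema D F delta (s1 ++ [:: p, q & s2]) ->
  p < q /\ ((peak delta D (flip F) p /\ peak delta D F q) \/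
            (peak delta D F p /\ peak delta D (flip F) q)).
Proof.
move=> D_sorted F_neq delta0 [y_sorted _ y_label y_alt].
move: y_sorted; rewrite sorted_cat_cons /= => /and3P[_ pq _].
move: y_label; rewrite all_cat /= => /and4P[_ label_p label_q _].
move: y_alt; rewrite sorted_cat_cons /= => /and3P[_ alt_pq _].
split=> //; case/orP: alt_pq => /andP[p_ext q_ext]; [right|left].
  by split; [apply/peakP|apply/valleyP].
by split; [apply/valleyP|apply/peakP].
Qed.

Definition tag_max {R : realType} (D : seq R) (F : R -> R) (x : R) : R * bool :=
  (x, is_maximum D F x).

Lemma tag_peak {R : realType} (delta : R) (D : seq R) (F : R -> R) (x : R) :
  sorted <%R D ->
  (forall i : nat, (i.+1 < size D)%N -> F D`_i != F D`_i.+1) ->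
  0 < delta -> peak delta D F x -> tag_max D F x = (x, true).
Proof. move=> D_sorted F_neq delta0 /(peakP D_sorted F_neq delta0)[x_max _].
by rewrite /tag_max x_max. Qed.

Lemma tag_valley {R : realType} (delta : R) (D : seq R) (F : R -> R) (x : R) :
  sorted <%R D ->
  (forall i : nat, (i.+1 < size D)%N -> F D`_i != F D`_i.+1) ->
  0 < delta -> peak delta D (flip F) x -> tag_max D F x = (x, false).
Proof.
move=> D_sorted F_neq delta0 valley_x; congr pair; apply/negP.
move=> /(is_maximumP _ _ _ D_sorted F_neq)[_].
exact: valley_not_local_max valley_x.
Qed.

Lemma consecutive_swing {R : realType} (delta : R) (D : seq R) (F : R -> R)
    (s1 s2 : seq R) (p q : R) :
  sorted <%R D ->
  (forall i : nat, (i.+1 < size D)%N -> F D`_i != F D`_i.+1) ->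
  0 < delta -> maximal_alternating_extrema D F delta (s1 ++ [:: p, q & s2]) ->
  p < q -> peak delta D (flip F) p -> peak delta D F q -> delta <= F q - F p.
Proof.
move=> D_sorted F_neq delta0 y_max pq valley_p peak_q.
have [Dp _ bottom_p] := valley_p; have [Dq _ top_q] := peak_q.
apply: (rise_ge_delta _ _ _ _ _ delta0 Dp Dq pq bottom_p top_q).
exact: (no_peak_valley_between _ _ _ _ _ _ _ D_sorted F_neq delta0 y_max).
Qed.

Lemma maximal_sorted_swing {R : realType} (delta c : R) (D : seq R) (F : R -> R)
    (y : seq R) :
  sorted <%R D ->
  (forall i : nat, (i.+1 < size D)%N -> F D`_i != F D`_i.+1) ->
  0 < delta -> maximal_alternating_extrema D F delta y -> c < delta ->
  sorted (swing F c) (map (tag_max D F) y).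
Proof.
move=> D_sorted F_neq delta0 y_max c_lt; rewrite sorted_map.
apply: sorted_consecutive => s1 p q s2 ey; rewrite ey in y_max.
have [pq] := consecutive_extrema _ _ _ _ _ _ _ D_sorted F_neq delta0 y_max.1.
have Fn_neq := consecutive_neq_flip F_neq.
move=> types; change (is_true (swing F c (tag_max D F p) (tag_max D F q))).
case: types => -[p_ext q_ext].
  rewrite (tag_valley _ _ _ _ D_sorted F_neq delta0 p_ext).
  rewrite (tag_peak _ _ _ _ D_sorted F_neq delta0 q_ext) /swing /= pq.
  exact: lt_le_trans c_lt
    (consecutive_swing _ _ _ _ _ _ _ D_sorted F_neq delta0 y_max pq p_ext q_ext).
rewrite (tag_peak _ _ _ _ D_sorted F_neq delta0 p_ext).
rewrite (tag_valley _ _ _ _ D_sorted F_neq delta0 q_ext) /swing /= pq.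
have y_max' := maximal_alternating_flip _ _ _ _ delta0 y_max.
have := consecutive_swing _ _ _ _ _ _ _ D_sorted Fn_neq delta0 y_max' pq.
rewrite flipK => /(_ p_ext q_ext).
by rewrite /flip; lra.
Qed.

(** Q enters only through the hypothesis that no chain of swings above c is longer than [y]. The
    direction of X is part of the conclusion because [omafe] depends on it and its invariance under
    [flip] is stated for directed segments. *)
Lemma segment_omafe_le {R : realType} (delta c : R) (D : seq R) (F : R -> R)
    (s1 s2 : seq R) (p q : R) (X : R * R) :
  let y := s1 ++ [:: p, q & s2] in
  sorted <%R D ->
  (forall i : nat, (i.+1 < size D)%N -> F D`_i != F D`_i.+1) ->
  0 < delta -> maximal_alternating_extrema D F delta y ->
  peak delta D (flip F) p -> peak delta D F q ->
  (0 < size s1 + size s2)%N ->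
  X.1 = (if s1 is [::] then head 0 D else p) ->
  X.2 = (if s2 is [::] then last 0 D else q) ->
  0 <= c ->
  (forall w, sorted (swing F c) w -> {in w, forall a, a.1 \in D} ->
    (size w <= size y)%N) ->
  F X.1 < F X.2 /\ omafe D F X <= c / 2.
Proof.
move=> y D_sorted F_neq delta0 y_max valley_p peak_q size_s eX1 eX2 c0 longest.
have [Dp _ bottom_p] := valley_p; have [Dq _ top_q] := peak_q.
have [pq _] := consecutive_extrema _ _ _ _ _ _ _ D_sorted F_neq delta0 y_max.1.
have nopv := no_peak_valley_between _ _ _ _ _ _ _ D_sorted F_neq delta0 y_max
  valley_p peak_q.
have le_q := rise_le_end _ _ _ _ _ delta0 Dp Dq pq bottom_p top_q nopv.
have ge_p := rise_ge_start _ _ _ _ _ delta0 Dp Dq pq bottom_p top_q nopv.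
have ge_delta := rise_ge_delta _ _ _ _ _ delta0 Dp Dq pq bottom_p top_q nopv.
have small u v := rise_drop_lt _ _ _ _ _ u v delta0 Dp Dq pq bottom_p top_q nopv.
have [head_le _] := sorted_head_last _ _ D_sorted Dp.
have [_ last_ge] := sorted_head_last _ _ D_sorted Dq.
have D0 : D != [::] by apply: contraTneq Dp => ->.
have [Dhead Dlast] : head 0 D \in D /\ last 0 D \in D.
  by case: (D) D0 => // d D' _; rewrite /= mem_head mem_last.
have X1p : X.1 <= p by rewrite eX1; case: (s1) => *; lra.
have qX2 : q <= X.2 by rewrite eX2; case: (s2) => *; lra.
have DX1 : X.1 \in D by rewrite eX1; case: (s1).
have DX2 : X.2 \in D by rewrite eX2; case: (s2).
have left_end u : u \in D -> X.1 <= u -> u <= p -> F p <= F u /\ F u < F p + delta.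
  case: s1 @y y_max eX1 {size_s longest} => [|z s1] y y_max eX1 Du Xu up.
    apply: (bottom_left_end _ _ _ _ delta0 Dp bottom_p) => //.
    exact: (no_peak_before _ _ _ _ _ D_sorted F_neq delta0 y_max).
  by have -> : u = p by [lra]; split; lra.
have right_end v : v \in D -> q <= v -> v <= X.2 -> F q - delta < F v /\ F v <= F q.
  case: s2 @y y_max eX2 {size_s longest} => [|z s2] y y_max eX2 Dv qv vX.
    have y_max' : maximal_alternating_extrema D (flip F) delta (rcons (rcons s1 p) q).
      by rewrite -!cats1 -catA; apply: maximal_alternating_flip.
    rewrite -[F]flipK in top_q peak_q.
    have := bottom_right_end delta D (flip F) q delta0 Dq top_q.
    have := no_peak_after _ _ _ _ _ D_sorted (consecutive_neq_flip F_neq) delta0 y_max'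
      peak_q.
    by move=> nopeak /(_ nopeak v Dv qv); rewrite /flip => -[? ?]; split; lra.
  by have -> : v = q by [lra]; split; lra.
(* At most one end of X is moved off [y]; it stays within less than [delta] of its extremum, while
   [F q - F p] is at least [delta]. *)
have incX : F X.1 < F X.2.
  have [_ ?] := left_end _ DX1 (lexx _) X1p; have [? _] := right_end _ DX2 qX2 (lexx _).
  case: (s1) (s2) size_s eX1 eX2 => [|z1 s1'] [|z2 s2'] //= _ eX1 eX2.
  - by rewrite eX2; lra.
  - by rewrite eX1; lra.
  by rewrite eX1 eX2; lra.
split=> //; apply: omafe_increasing_le => // u v Du Dv Xu uv vX.
rewrite leNgt; apply/negP => big.
have tag_p := tag_valley _ _ _ _ D_sorted F_neq delta0 valley_p.
have tag_q := tag_peak _ _ _ _ D_sorted F_neq delta0 peak_q.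
have y_swings := maximal_sorted_swing _ c _ _ _ D_sorted F_neq delta0 y_max.
have yD : {in map (tag_max D F) y, forall a, a.1 \in D}.
  move=> _ /mapP[x yx ->] /=; have [[_ /allP/(_ x yx) + _ _] _] := y_max.
  by rewrite /Defs.extremum => /orP[] /andP[].
(* As [F p <= F v], the drop from u to p is also larger than c, so u can be put before [y]; its
   height below [F p + delta] gives c < [delta]. *)
have [up|pu] := ltP u p.
  have es1 : s1 = [::] by case: (s1) eX1 => // z s1' eX1; move: Xu; rewrite eX1 leNgt up.
  have qX2' : X.2 = q by move: size_s eX2; rewrite es1; case: (s2).
  have Fpv : F p <= F v.
    have [vp|pv] := lerP v p; first by have [|//] := left_end v Dv _ vp; lra.
    by apply: ge_p => //; lra.
  have [_ Fu] := left_end u Du Xu (ltW up).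
  have : (size ((u, true) :: map (tag_max D F) y) <= size y)%N; last first.
    by rewrite /= size_map ltnn.
  apply: longest.
    have /y_swings : c < delta by lra.
    by rewrite /y es1 /= tag_p /swing /= up => -> /=; lra.
  by move=> a; rewrite inE => /orP[/eqP->|/yD].
have [qv|vq] := ltP q v.
  have es2 : s2 = [::] by case: (s2) eX2 => // z s2' eX2; move: vX; rewrite eX2 leNgt qv.
  have pX1' : X.1 = p by move: size_s eX1; rewrite es2; case: (s1).
  have Fuq : F u <= F q.
    have [uq|qu] := lerP u q; first by apply: le_q.
    by have [||//] := right_end u Du; lra.
  have [Fv _] := right_end v Dv (ltW qv) vX.
  have : (size (rcons (map (tag_max D F) y) (v, false)) <= size y)%N; last first.
    by rewrite size_rcons size_map ltnn.
  apply: longest.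
    have /y_swings : c < delta by lra.
    rewrite /y es2 -[[:: p; q]]cat1s catA map_cat rcons_cat /=.
    rewrite !sorted_cat_cons /= !andbT => -> /=.
    by rewrite tag_q /swing /= qv; lra.
  by move=> a; rewrite mem_rcons inE => /orP[/eqP->|/yD].
(* Inside [p, q] the rises from p to u and from v to q are at least the drop from u to v, so all
   three moves exceed c. *)
have Fu := le_q u Du pu (ltW (lt_le_trans uv vq)).
have Fv := ge_p v Dv (ltW (le_lt_trans pu uv)) vq.
have Fuv := small u v Du Dv pu uv vq.
have neq_pu : p != u by apply/eqP => e; move: big; rewrite -e; lra.
have neq_vq : v != q by apply/eqP => e; move: big; rewrite e; lra.
have {}pu : p < u by rewrite lt_neqAle neq_pu.
have {}vq : v < q by rewrite lt_neqAle neq_vq.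
pose w := map (tag_max D F) s1 ++
  [:: tag_max D F p, (u, true), (v, false), tag_max D F q & map (tag_max D F) s2].
have : (size w <= size y)%N; last first.
  by rewrite !size_cat /= !size_map leq_add2l !ltnS ltnNge leqnSn.
apply: longest.
  have /y_swings : c < delta by lra.
  rewrite /y map_cat /= !sorted_cat_cons /= => /and3P[-> _ ->].
  by rewrite tag_p tag_q /swing /= pu uv vq /=; lra.
move=> a; rewrite mem_cat !inE => a_in.
have [/eqP->//|nu] := boolP (a == (u, true)).
have [/eqP->//|nv] := boolP (a == (v, false)).
by apply: yD; move: a_in; rewrite (negPf nu) (negPf nv) /y map_cat mem_cat /= !inE.
Qed.

Theorem theorem3p8 (R : realType) (D : seq R) (F : R -> R)
  (D_sorted : sorted <%R D)
  (F_neq : forall i : nat, (i.+1 < size D)%N -> F D`_i != F D`_i.+1)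
  (delta : R) (delta_gt0 : 0 < delta)
  (K : nat) (y : seq R)
  (y_size : size y = K.+1)
  (y_max : maximal_alternating_extrema D F delta y)
  (Q : seq R)
  (Q_seg : segmentation D Q)
  (Q_alt : alternating F Q)
  (Q_better : omafe_seg D F Q < omafe_seg D F (derived_segmentation D y)) :
  (K.+1 <= size (segments Q))%N.
Proof.
rewrite ltnNge; apply/negP => Q_size.
(* A labelled extremum is an end of a pair, so D has two points and Q has at least one segment. *)
have [x [x' [Dx Dx' lt_x]]] : exists x x', [/\ x \in D, x' \in D & x < x'].
  case: y y_size y_max {Q_better} => // y0 y _ [[_ _ /= /andP[label_y0 _] _] _].
  have [p [[[d _ [Dp1 Dp2 ltp _ _]] _] _ _]] :=
    (scale_label_geP _ _ _ _ delta_gt0).1 label_y0.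
  by exists p.1, p.2.
have lt_D : head 0 D < last 0 D.
  have [? _] := sorted_head_last _ _ D_sorted Dx.
  by have [_ ?] := sorted_head_last _ _ D_sorted Dx'; lra.
case: Q Q_seg Q_alt Q_better Q_size => [[]//|q0 [|q1 qs]].
  by move=> [_ _ _ /= eq0 eq1]; move: lt_D; rewrite -eq0 -eq1 ltxx.
set Q := [:: q0, q1 & qs] => Q_seg Q_alt Q_better Q_size.
(* With K = 1 the only segment of P may run against y (both of its ends may lie
   outside y), but then Q also has just one segment and equals P. *)
have [y2|y2] := ltnP 2 (size y); last first.
  have K1 : K = 1%N.
    apply/eqP; rewrite eqn_leq; apply/andP; split; first by rewrite y_size in y2.
    exact: leq_trans Q_size.
  case: qs @Q Q_seg Q_alt Q_better Q_size => [|q2 qs] Q Q_seg _ Q_better Q_size; last first.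
    by rewrite K1 in Q_size.
  case: Q_seg => _ _ _ /= eq0 eq1.
  move: Q_better; rewrite /Q eq0 eq1 K1 in y_size *.
  by case: y y_size {y_max y2} => [|a [|b []]] //= _; rewrite ltxx.
set c := 2 * omafe_seg D F Q.
have c0 : 0 <= c by apply: mulr_ge0 => //; apply: bigmax_ge_id.
(* At most K segments in Q allow at most K swings above c, hence K + 1 points, the size of [y]. *)
have longest w : sorted (swing F c) w -> {in w, forall a, a.1 \in D} ->
    (size w <= size y)%N.
  move=> w_sorted wD; rewrite y_size.
  apply: leq_trans (swings_bound _ _ _ _ D_sorted Q_seg Q_alt w_sorted wD) _.
  by rewrite ltnS.
have longest_flip w : sorted (swing (flip F) c) w -> {in w, forall a, a.1 \in D} ->
    (size w <= size y)%N.
  rewrite /c -(omafe_seg_flip _ _ _ Q_alt) => w_sorted wD; rewrite y_size.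
  have := swings_bound _ _ _ _ D_sorted Q_seg (alternating_flip _ _ Q_alt) w_sorted wD.
  by move=> /leq_trans; apply; rewrite ltnS.
move: Q_better; apply/negP; rewrite -leNgt /omafe_seg big_seq.
apply: bigmax_le => [|X]; first exact: bigmax_ge_id.
move=> /(mem_segments_derived _ _ _ y2)[s1 [p [q [s2 [ey size_s eX1 eX2]]]]].
have -> : \big[Order.max/0]_(Z <- segments Q) omafe D F Z = c / 2.
  by rewrite /c mulrC mulKf // pnatr_eq0.
rewrite {}ey in y_max longest longest_flip.
have [_ []] := consecutive_extrema _ _ _ _ _ _ _ D_sorted F_neq delta_gt0 y_max.1.
  move=> [valley_p peak_q].
  by have [] := segment_omafe_le _ _ _ _ _ _ _ _ X D_sorted F_neq delta_gt0 y_max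
    valley_p peak_q size_s eX1 eX2 c0 longest.
(* A falling segment is a rising one of [flip F]. *)
rewrite -{1}[F]flipK => -[valley_p peak_q].
have [incX] := segment_omafe_le _ _ _ _ _ _ _ _ X D_sorted
  (consecutive_neq_flip F_neq) delta_gt0 (maximal_alternating_flip _ _ _ _ delta_gt0 y_max)
  valley_p peak_q size_s eX1 eX2 c0 longest_flip.
by rewrite omafe_flip // neq_lt -[F X.2 < _]ltrN2 incX orbT.
Qed.
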